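(* Let $f\colon B\to A$, $g\colon C\to A$ and $\ell\colon C\to B$ be functors of quasi-categories. Given a 2-cell $\lambda\colon f\ell\Rightarrow g$ in $\mathrm{qCat}_2$, let $w\colon B\downarrow\ell\to f\downarrow g$ be any functor satisfying $$q_0w=p_0,\qquad q_1w=p_1,\qquad \psi w=\lambda p_1\cdot f\phi .$$ The assignment $\lambda\mapsto[w]$ is a well-defined bijection between 2-cells $\lambda\colon f\ell\Rightarrow g$ and isomorphism classes of 1-cells $w$ from $(p_1,p_0)\colon B\downarrow\ell\to C\times B$ to $(q_1,q_0)\colon f\downarrow g\to C\times B$ in the slice 2-category $\mathrm{qCat}_2/(C\times B)$. Furthermore, $\lambda$ displays $\ell$ as an absolute right lifting of $g$ through $f$ if and only if any representative $w$ of the corresponding isomorphism class is an equivalence.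
   Context: A quasi-category is a simplicial set with fillers for all inner horns; functors are simplicial maps between quasi-categories. $\mathrm{qCat}_2$ is the strict 2-category of quasi-categories with hom-categories $\hom'(A,B)=h(B^A)$, where $B^A$ is the internal hom and $h\colon\mathrm{sSet}\to\mathrm{Cat}$ is left adjoint to the nerve. Equivalence means equivalence in $\mathrm{qCat}_2$. For functors $f\colon B\to A$, $g\colon C\to A$ the comma quasi-category $f\downarrow g$ is the pullback of $(\mathrm{cod},\mathrm{dom})\colon A^{\Delta^1}\to A\times A$ along $g\times f\colon C\times B\to A\times A$, with projections $q_1\colon f\downarrow g\to C$, $q_0\colon f\downarrow g\to B$; the projection to $A^{\Delta^1}$ transposes to a representative of a canonical 2-cell $\psi\colon fq_0\Rightarrow gq_1$. Similarly $B\downarrow\ell:=\mathrm{id}_B\downarrow\ell$ has projections $p_1\colon B\downarrow\ell\to C$, $p_0\colon B\downarrow\ell\to B$ and a canonical 2-cell $\phi\colon p_0\Rightarrow\ell p_1$. By the weak universal property of $f\downarrow g$, for any $b\colon X\to B$, $c\colon X\to C$ and 2-cell $\alpha\colon fb\Rightarrow gc$ there exists $a\colon X\to f\downarrow g$ with $q_0a=b$, $q_1a=c$, $\psi a=\alpha$. In $\mathrm{qCat}_2/(C\times B)$, 1-cells are functors commuting strictly with the maps to $C\times B$, and 2-cells are 2-cells of $\mathrm{qCat}_2$ whose whiskering with the codomain's map to $C\times B$ is an identity; two 1-cells are isomorphic if there is an invertible such 2-cell between them. $\lambda\colon f\ell\Rightarrow g$ displays $\ell$ as an absolute right lifting of $g$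 through $f$ if for all $b\colon X\to B$, $c\colon X\to C$ and every 2-cell $\chi\colon fb\Rightarrow gc$ there is a unique 2-cell $\zeta\colon b\Rightarrow\ell c$ with $\chi=\lambda c\cdot f\zeta$. *)

(* Defs.v *)
From mathcomp Require Import boolp.
From mathcomp Require Import all_boot.

Set Implicit Arguments.
Unset Strict Implicit.
Unset Printing Implicit Defensive.

Declare Scope qcat_scope.
Delimit Scope qcat_scope with qcat.
Local Open Scope qcat_scope.

Lemma sval_inj (T : Type) (P : T -> Prop) (x y : {x | P x}) :
  sval x = sval y -> x = y.
Proof. by case: x y => x xP [y yP] /=; apply: eq_exist. Qed.

(* [quot R] is the set of equivalence classes when [R] is an equivalence. *)
Definition quot (T : Type) (R : T -> T -> Prop) : Type :=
  {P : T -> Prop | exists x, P = R x}.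

Definition cls (T : Type) (R : T -> T -> Prop) (x : T) : quot R :=
  exist _ (R x) (ex_intro _ x erefl).
Arguments cls {T} R x.

Record equivalence_rel (T : Type) (R : T -> T -> Prop) : Prop := EquivalenceRel {
  eqv_refl : forall x, R x x;
  eqv_sym : forall x y, R x y -> R y x;
  eqv_trans : forall x y z, R x y -> R y z -> R x z }.

Definition repr (T : Type) (R : T -> T -> Prop) (q : quot R) : T :=
  projT1 (cid (proj2_sig q)).

Section Quot.
Variables (T : Type) (R : T -> T -> Prop).

Lemma reprK (q : quot R) : cls R (repr q) = q.
Proof.
by apply: sval_inj; rewrite /repr; case: (cid _) => x /= ->.
Qed.

Lemma quotP (q : quot R) : exists x, q = cls R x.
Proof. by exists (repr q); rewrite reprK. Qed.

Hypothesis eqvR : equivalence_rel R.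

Lemma cls_eq x y : (cls R x = cls R y) <-> R x y.
Proof.
split=> [[] exy|Rxy].
  by rewrite exy; apply: eqv_refl eqvR _.
apply: sval_inj; apply: funext => z; apply: propext; split=> h.
  exact: (eqv_trans eqvR (eqv_sym eqvR Rxy) h).
exact: (eqv_trans eqvR Rxy h).
Qed.

Lemma repr_cls x : R (repr (cls R x)) x.
Proof. by apply/cls_eq; rewrite reprK. Qed.

End Quot.

Record category := Category {
  obj :> Type;
  hom : obj -> obj -> Type;
  idm : forall x, hom x x;
  comp : forall x y z, hom y z -> hom x y -> hom x z;
  comp1m : forall x y (a : hom x y), comp (idm y) a = a;
  compm1 : forall x y (a : hom x y), comp a (idm x) = a;
  compmA : forall x y z t (c : hom z t) (b : hom y z) (a : hom x y),
    comp c (comp b a) = comp (comp c b) a }.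
Arguments hom {c} x y : rename.
Arguments idm {c} x : rename.
Arguments comp {c x y z} b a : rename.

Record functor (C D : category) := Functor {
  fobj :> C -> D;
  fhom : forall x y, hom x y -> hom (fobj x) (fobj y);
  fhom1 : forall x, fhom (idm x) = idm (fobj x);
  fhomM : forall x y z (b : hom y z) (a : hom x y),
    fhom (comp b a) = comp (fhom b) (fhom a) }.
Arguments fhom {C D} f {x y} a : rename.

Lemma fcomp_id (C D E : category) (G : functor D E) (F : functor C D) x :
  fhom G (fhom F (idm x)) = idm (G (F x)).
Proof. by rewrite !fhom1. Qed.

Lemma fcomp_comp (C D E : category) (G : functor D E) (F : functor C D)
    x y z (b : hom y z) (a : hom x y) :
  fhom G (fhom F (comp b a)) = comp (fhom G (fhom F b)) (fhom G (fhom F a)).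
Proof. by rewrite !fhomM. Qed.

Definition fcomp (C D E : category) (G : functor D E) (F : functor C D) :
    functor C E :=
  @Functor C E (fun x => G (F x)) (fun x y a => fhom G (fhom F a))
    (fcomp_id G F) (fcomp_comp G F).

Definition isomorphic (C : category) (x y : C) : Prop :=
  exists (a : hom x y) (b : hom y x), comp b a = idm x /\ comp a b = idm y.

Lemma isomorphic_equiv (C : category) : equivalence_rel (@isomorphic C).
Proof.
split=> [x|x y [a [b [ba ab]]]|x y z [a [b [ba ab]]] [c [d [dc cd]]]].
- by exists (idm x), (idm x); rewrite comp1m.
- by exists b, a.
- exists (comp c a), (comp b d); split.
    by rewrite compmA -(compmA b) dc compm1.
  by rewrite compmA -(compmA c) ab compm1.
Qed.

Definition iso_class (C : category) : Type := quot (@isomorphic C).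
Definition class_of (C : category) (x : C) : iso_class C := cls _ x.

(* Transport of a morphism along equalities of its endpoints. *)
Definition hcast (C : category) (x x' y y' : C) (ex : x = x') (ey : y = y')
    (a : hom x y) : hom x' y' :=
  ecast z (hom z y') ex (ecast z (hom x z) ey a).

Lemma hcast_comp (C : category) (x x' y y' z z' : C) (ex : x = x')
    (ey : y = y') (ez : z = z') (b : hom y z) (a : hom x y) :
  hcast ex ez (comp b a) = comp (hcast ey ez b) (hcast ex ey a).
Proof. by case: _ / ex; case: _ / ey; case: _ / ez. Qed.

Lemma hcast_idm (C : category) (x x' : C) (e e' : x = x') :
  hcast e e' (idm x) = idm x'.
Proof. by rewrite (Prop_irrelevance e' e); case: _ / e. Qed.

Lemma hcast_id (C : category) (x y : C) (ex : x = x) (ey : y = y)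
  (a : hom x y) : hcast ex ey a = a.
Proof.
by rewrite (Prop_irrelevance ex erefl) (Prop_irrelevance ey erefl).
Qed.

Record mono (m n : nat) := Mono {
  mono_fun :> 'I_m.+1 -> 'I_n.+1;
  monoP : forall i j : 'I_m.+1, i <= j -> mono_fun i <= mono_fun j }.

Lemma mono_ext m n (s t : mono m n) : s =1 t -> s = t.
Proof.
case: s t => [s sP] [t tP] /= /funext e; case: _ / e tP => tP.
by congr Mono; apply: Prop_irrelevance.
Qed.

Definition mono_id n : mono n n := @Mono n n id (fun _ _ h => h).

Definition mono_comp l m n (t : mono m n) (s : mono l m) : mono l n :=
  @Mono l n (fun i => t (s i)) (fun i j h => monoP t (monoP s h)).

Definition vert n (i : 'I_n.+1) : mono 0 n :=
  @Mono 0 n (fun=> i) (fun _ _ _ => leqnn i).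

Definition degen n : mono n 0 :=
  @Mono n 0 (fun=> ord0) (fun _ _ _ => leqnn 0).

Lemma edge_op_mono n (i j : 'I_n.+1) (ij : i <= j) (k l : 'I_2) :
  k <= l -> (if k == ord0 then i else j) <= (if l == ord0 then i else j).
Proof.
by case: k l => [[|[|//]] ?] [[|[|//]] ?].
Qed.

Definition edge_op n (i j : 'I_n.+1) (ij : i <= j) : mono 1 n :=
  @Mono 1 n (fun k => if k == ord0 then i else j) (edge_op_mono ij).

Record sSet := SSet {
  simplex :> nat -> Type;
  act : forall m n, mono m n -> simplex n -> simplex m;
  act_id : forall n (x : simplex n), act (mono_id n) x = x;
  act_comp : forall l m n (t : mono m n) (s : mono l m) (x : simplex n),
    act (mono_comp t s) x = act s (act t x) }.
Arguments act {s m n} t x : rename.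

Record smap (X Y : sSet) := SMap {
  smap_fun :> forall n, X n -> Y n;
  smap_nat : forall m n (t : mono m n) (x : X n),
    smap_fun (act t x) = act t (smap_fun x) }.
Arguments smap_fun {X Y} s n x : rename.

Lemma smap_ext (X Y : sSet) (f g : smap X Y) :
  (forall n (x : X n), f n x = g n x) -> f = g.
Proof.
case: f g => [f fP] [g gP] /= e.
have {}e : f = g by apply: functional_extensionality_dep => n; apply: funext.
by case: _ / e gP => gP; congr SMap; apply: Prop_irrelevance.
Qed.

Definition sid (X : sSet) : smap X X := @SMap X X (fun _ x => x) (fun _ _ _ _ => erefl).

Lemma scomp_nat (X Y Z : sSet) (g : smap Y Z) (f : smap X Y) m n
  (t : mono m n) (x : X n) : g _ (f _ (act t x)) = act t (g _ (f _ x)).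
Proof. by rewrite !smap_nat. Qed.

Definition scomp (X Y Z : sSet) (g : smap Y Z) (f : smap X Y) : smap X Z :=
  @SMap X Z (fun n x => g n (f n x)) (@scomp_nat X Y Z g f).

Notation "g ∘ f" := (scomp g f) (at level 40, left associativity) : qcat_scope.

Lemma scompA (X Y Z T : sSet) (h : smap Z T) (g : smap Y Z) (f : smap X Y) :
  h ∘ g ∘ f = h ∘ (g ∘ f).
Proof. exact: smap_ext. Qed.

Lemma scomp1s (X Y : sSet) (f : smap X Y) : sid Y ∘ f = f.
Proof. exact: smap_ext. Qed.

Lemma scomps1 (X Y : sSet) (f : smap X Y) : f ∘ sid X = f.
Proof. exact: smap_ext. Qed.

Lemma simp_act_id k n (x : mono n k) : mono_comp x (mono_id n) = x.
Proof. exact: mono_ext. Qed.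

Definition simp (k : nat) : sSet :=
  @SSet (fun n => mono n k) (fun m n t x => mono_comp x t)
    (@simp_act_id k) (fun _ _ _ _ _ _ => erefl).

Section Subobject.
Variables (X : sSet) (P : forall n, X n -> Prop).
Hypothesis P_act : forall m n (t : mono m n) (x : X n), P x -> P (act t x).

Definition ssub_act m n (t : mono m n) (x : {x : X n | P x}) : {x : X m | P x} :=
  exist (@P m) (act t (sval x)) (P_act t (svalP x)).

Lemma ssub_act_id n (x : {x : X n | P x}) : ssub_act (mono_id n) x = x.
Proof. by apply: sval_inj; apply: act_id. Qed.

Lemma ssub_act_comp l m n (t : mono m n) (s : mono l m) (x : {x : X n | P x}) :
  ssub_act (mono_comp t s) x = ssub_act s (ssub_act t x).
Proof. by apply: sval_inj; apply: act_comp. Qed.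

Definition ssub : sSet :=
  @SSet (fun n => {x : X n | P x}) ssub_act ssub_act_id ssub_act_comp.

Definition ssub_incl : smap ssub X :=
  @SMap ssub X (fun _ x => sval x) (fun _ _ _ _ => erefl).

End Subobject.

(* An [n]-simplex of the horn is a map [n] -> [k] missing a vertex other than
   the [i]-th. *)
Definition in_horn k (i : 'I_k.+1) n (x : simp k n) : Prop :=
  exists j : 'I_k.+1, j != i /\ forall a, (x : mono n k) a != j.

Lemma in_horn_act k (i : 'I_k.+1) m n (t : mono m n) (x : simp k n) :
  in_horn i x -> in_horn i (act t x).
Proof. by move=> [j [ji xj]]; exists j; split=> // a; apply: xj. Qed.

Definition horn k (i : 'I_k.+1) : sSet := ssub (@in_horn_act k i).

Definition horn_incl k (i : 'I_k.+1) : smap (horn i) (simp k) :=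
  ssub_incl (@in_horn_act k i).

Definition quasicategory (X : sSet) : Prop :=
  forall k (i : 'I_k.+1), 0 < i < k ->
  forall h : smap (horn i) X, exists s : smap (simp k) X, s ∘ horn_incl i = h.

Lemma sprod_act_id (X Y : sSet) n (x : X n * Y n) :
  (act (mono_id n) x.1, act (mono_id n) x.2) = x.
Proof. by case: x => x y; rewrite !act_id. Qed.

Lemma sprod_act_comp (X Y : sSet) l m n (t : mono m n) (s : mono l m)
    (x : X n * Y n) :
  (act (mono_comp t s) x.1, act (mono_comp t s) x.2) =
  (act s (act t x.1), act s (act t x.2)).
Proof. by rewrite !act_comp. Qed.

Definition sprod (X Y : sSet) : sSet :=
  @SSet (fun n => (X n * Y n)%type) (fun m n t x => (act t x.1, act t x.2))
    (@sprod_act_id X Y) (@sprod_act_comp X Y).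

Definition sfst (X Y : sSet) : smap (sprod X Y) X :=
  @SMap (sprod X Y) X (fun _ x => x.1) (fun _ _ _ _ => erefl).

Definition ssnd (X Y : sSet) : smap (sprod X Y) Y :=
  @SMap (sprod X Y) Y (fun _ x => x.2) (fun _ _ _ _ => erefl).

Lemma spair_nat (Z X Y : sSet) (f : smap Z X) (g : smap Z Y) m n
    (t : mono m n) (z : Z n) :
  (f _ (act t z), g _ (act t z)) = (act t (f _ z), act t (g _ z)).
Proof. by rewrite !smap_nat. Qed.

Definition spair (Z X Y : sSet) (f : smap Z X) (g : smap Z Y) :
    smap Z (sprod X Y) :=
  @SMap Z (sprod X Y) (fun n z => (f n z, g n z)) (@spair_nat Z X Y f g).

Definition sprodmap (X X' Y Y' : sSet) (f : smap X X') (g : smap Y Y') :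
    smap (sprod X Y) (sprod X' Y') :=
  spair (f ∘ sfst X Y) (g ∘ ssnd X Y).

Section Pullback.
Variables (E F G : sSet) (p : smap E G) (q : smap F G).

Definition in_spull n (x : sprod E F n) : Prop := p n x.1 = q n x.2.

Lemma in_spull_act m n (t : mono m n) (x : sprod E F n) :
  in_spull x -> in_spull (act t x).
Proof. by rewrite /in_spull /= !smap_nat => ->. Qed.

Definition spull : sSet := ssub in_spull_act.
Definition spull1 : smap spull E := sfst E F ∘ ssub_incl in_spull_act.
Definition spull2 : smap spull F := ssnd E F ∘ ssub_incl in_spull_act.

Lemma spull_sq : p ∘ spull1 = q ∘ spull2.
Proof. by apply: smap_ext => n [x xP]. Qed.

End Pullback.

Definition simpmap m n (t : mono m n) : smap (simp m) (simp n) :=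
  @SMap (simp m) (simp n) (fun _ x => mono_comp t x) (fun _ _ _ _ => erefl).

Section InternalHom.
Variables (B A : sSet).

Definition sexp_act m n (t : mono m n) (u : smap (sprod (simp n) A) B) :
    smap (sprod (simp m) A) B :=
  u ∘ sprodmap (simpmap t) (sid A).

Lemma sexp_act_id n (u : smap (sprod (simp n) A) B) :
  sexp_act (mono_id n) u = u.
Proof.
apply: smap_ext => k [x a] /=.
by rewrite (_ : mono_comp _ _ = x) //; apply: mono_ext.
Qed.

Lemma sexp_act_comp l m n (t : mono m n) (s : mono l m)
    (u : smap (sprod (simp n) A) B) :
  sexp_act (mono_comp t s) u = sexp_act s (sexp_act t u).
Proof. by apply: smap_ext. Qed.

(* The internal hom B^A; its n-simplices are the maps Delta^n x A -> B. *)
Definition sexp : sSet :=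
  @SSet (fun n => smap (sprod (simp n) A) B) sexp_act sexp_act_id sexp_act_comp.

Definition vtx (f : smap A B) : sexp 0 := f ∘ ssnd (simp 0) A.

Lemma degen_nat m n (t : mono m n) : degen m = mono_comp (degen n) t.
Proof. exact: mono_ext. Qed.

Lemma unvtx_nat (u : sexp 0) m n (t : mono m n) (x : A n) :
  (u : smap _ _) m (degen m, act t x) = act t ((u : smap _ _) n (degen n, x)).
Proof. by rewrite -smap_nat /= -degen_nat. Qed.

Definition unvtx (u : sexp 0) : smap A B :=
  @SMap A B (fun n x => (u : smap _ _) n (degen n, x)) (@unvtx_nat u).

Lemma vtxK : cancel vtx unvtx.
Proof. by move=> f; apply: smap_ext. Qed.

Lemma unvtxK : cancel unvtx vtx.
Proof.
move=> u; apply: smap_ext => n [x a] /=.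
congr ((u : smap _ _) n (_, a)); apply: mono_ext => i.
by apply: val_inj => /=; case: (x i) => [[]].
Qed.

(* 1-cells A -> B are the objects of h(B^A). *)
Lemma vtx_bij : bijective vtx.
Proof. by exists unvtx; [apply: vtxK|apply: unvtxK]. Qed.

End InternalHom.

Lemma sexp_pre_nat (X A B : sSet) (k : smap X A) m n (t : mono m n)
    (u : sexp B A n) :
  (act t u : smap _ _) ∘ sprodmap (sid (simp m)) k =
  act (s:=sexp B X) t ((u : smap _ _) ∘ sprodmap (sid (simp n)) k).
Proof. exact: smap_ext. Qed.

Definition sexp_pre (X A B : sSet) (k : smap X A) : smap (sexp B A) (sexp B X) :=
  @SMap (sexp B A) (sexp B X)
    (fun n (u : smap _ _) => u ∘ sprodmap (sid (simp n)) k)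
    (@sexp_pre_nat X A B k).

Lemma sexp_post_nat (A B D : sSet) (h : smap B D) m n (t : mono m n)
    (u : sexp B A n) :
  h ∘ (act t u : smap _ _) = act (s:=sexp D A) t (h ∘ (u : smap _ _)).
Proof. exact: smap_ext. Qed.

Definition sexp_post (A B D : sSet) (h : smap B D) : smap (sexp B A) (sexp D A) :=
  @SMap (sexp B A) (sexp D A) (fun n (u : smap _ _) => h ∘ u)
    (@sexp_post_nat A B D h).

Definition ordc (n : nat) : category :=
  @Category 'I_n.+1 (fun i j => i <= j : Type) (fun i => leqnn i)
    (fun i j k (jk : j <= k) (ij : i <= j) => leq_trans ij jk)
    (fun _ _ _ => Prop_irrelevance _ _) (fun _ _ _ => Prop_irrelevance _ _)
    (fun _ _ _ _ _ _ _ => Prop_irrelevance _ _).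

Lemma ordc_irr n (i j : ordc n) (a b : hom i j) : a = b.
Proof. exact: (Prop_irrelevance (P:=i <= j)). Qed.

Definition ordf m n (t : mono m n) : functor (ordc m) (ordc n) :=
  @Functor (ordc m) (ordc n) t (fun i j ij => monoP t ij)
    (fun _ => ordc_irr _ _) (fun _ _ _ _ _ => ordc_irr _ _).

(* A morphism together with its endpoints. *)
Definition arrow (C : category) : Type := {e : C * C & hom e.1 e.2}.

Definition tarr (C : category) (x y : C) (a : hom x y) : arrow C :=
  existT (fun e : C * C => hom e.1 e.2) (x, y) a.

Section Arrow.
Variable C : category.

Lemma tarr_hcast (x x' y y' : C) (ex : x = x') (ey : y = y') (a : hom x y) :
  tarr (hcast ex ey a) = tarr a.
Proof. by case: _ / ex; case: _ / ey. Qed.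

Lemma tarrP (x x' y y' : C) (a : hom x y) (b : hom x' y') :
  tarr a = tarr b -> exists (ex : x = x') (ey : y = y'), hcast ex ey a = b.
Proof.
suff H (t t' : arrow C) : t = t' -> exists (ex : (tag t).1 = (tag t').1)
    (ey : (tag t).2 = (tag t').2), hcast ex ey (tagged t) = tagged t'.
  by move=> /H.
by move=> <-; exists erefl, erefl.
Qed.

Lemma tarr_inj (x y : C) (a b : hom x y) : tarr a = tarr b -> a = b.
Proof. by move=> /tarrP[ex [ey <-]]; rewrite hcast_id. Qed.

Lemma tarr_idm (x y : C) : x = y -> tarr (idm x) = tarr (idm y).
Proof. by move=> ->. Qed.

Lemma tarr_comp (x x' y y' z z' : C) (b : hom y z) (b' : hom y' z')
    (a : hom x y) (a' : hom x' y') :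
  tarr a = tarr a' -> tarr b = tarr b' -> tarr (comp b a) = tarr (comp b' a').
Proof.
move=> /tarrP[ex [ey <-]] /tarrP[ey' [ez <-]].
by rewrite (Prop_irrelevance ey' ey) -(hcast_comp ex ey ez) tarr_hcast.
Qed.

Lemma tarr_fhom (D : category) (F : functor C D) (x x' y y' : C)
    (a : hom x y) (a' : hom x' y') :
  tarr a = tarr a' -> tarr (fhom F a) = tarr (fhom F a').
Proof.
move=> /tarrP[ex [ey <-]].
by case: _ / ex; case: _ / ey.
Qed.

End Arrow.

Lemma functor_ext (C D : category) (F G : functor C D) :
  (forall x y (a : hom x y), tarr (fhom F a) = tarr (fhom G a)) -> F = G.
Proof.
case: F G => [F Fh F1 FM] [G Gh G1 GM] /= e.
have eFG : F = G.
  apply: funext => x.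
  by exact: (congr1 (fun t : arrow D => (tag t).1) (e x x (idm x))).
case: _ / eFG Gh G1 GM e => Gh G1 GM e.
have eh : Fh = Gh.
  do 3!(apply: functional_extensionality_dep => ?).
  exact: (tarr_inj (e _ _ _)).
case: _ / eh G1 GM e => G1 GM _.
by congr Functor; apply: Prop_irrelevance.
Qed.

Lemma functor_eq_arr (C D : category) (F G : functor C D) (x y : C)
    (a : hom x y) : F = G -> tarr (fhom F a) = tarr (fhom G a).
Proof. by move=> ->. Qed.

Lemma nerve_act_id (C : category) n (F : functor (ordc n) C) :
  fcomp F (ordf (mono_id n)) = F.
Proof.
apply: functor_ext => i j ij /=.
by congr (tarr (fhom F _)); apply: ordc_irr.
Qed.

Lemma nerve_act_comp (C : category) l m n (t : mono m n) (s : mono l m)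
    (F : functor (ordc n) C) :
  fcomp F (ordf (mono_comp t s)) = fcomp (fcomp F (ordf t)) (ordf s).
Proof.
apply: functor_ext => i j ij /=.
by congr (tarr (fhom F _)); apply: ordc_irr.
Qed.

Definition nerve (C : category) : sSet :=
  @SSet (fun n => functor (ordc n) C) (fun m n t F => fcomp F (ordf t))
    (@nerve_act_id C) (@nerve_act_comp C).

Lemma nerve_map_nat (C D : category) (G : functor C D) m n (t : mono m n)
    (F : functor (ordc n) C) :
  fcomp G (fcomp F (ordf t)) = fcomp (fcomp G F) (ordf t).
Proof. exact: functor_ext. Qed.

Definition nerve_map (C D : category) (G : functor C D) :
    smap (nerve C) (nerve D) :=
  @SMap (nerve C) (nerve D) (fun n F => fcomp G F) (@nerve_map_nat C D G).

Section HomotopyCategory.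
Variable X : sSet.

Definition src (e : X 1) : X 0 := act (@vert 1 ord0) e.
Definition tgt (e : X 1) : X 0 := act (@vert 1 ord_max) e.

Definition edge (x y : X 0) : Type := {e : X 1 | src e = x /\ tgt e = y}.

Inductive path : X 0 -> X 0 -> Type :=
| pnil x : path x x
| pcons x y z : edge x y -> path y z -> path x z.

Definition pone x y (e : edge x y) : path x y := pcons e (pnil y).

Fixpoint pcat x y z (p : path x y) : path y z -> path x z :=
  match p in path x y return path y z -> path x z with
  | pnil _ => id
  | pcons _ _ _ e p' => fun q => pcons e (pcat p' q)
  end.

Lemma pcats0 x y (p : path x y) : pcat p (pnil y) = p.
Proof. by elim: p => //= {}x {}y z e p ->. Qed.

Lemma pcatA x y z t (p : path x y) (q : path y z) (r : path z t) :
  pcat (pcat p q) r = pcat p (pcat q r).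
Proof. by elim: p q => //= {}x {}y w e p IH q; rewrite IH. Qed.

Definition face01 : mono 1 2 :=
  @edge_op 2 (@Ordinal 3 0 isT) (@Ordinal 3 1 isT) isT.
Definition face12 : mono 1 2 :=
  @edge_op 2 (@Ordinal 3 1 isT) (@Ordinal 3 2 isT) isT.
Definition face02 : mono 1 2 :=
  @edge_op 2 (@Ordinal 3 0 isT) (@Ordinal 3 2 isT) isT.

(* The congruence on the free category on the graph X_1 => X_0 generated by
   s_0 x ~ id_x and d_0 s . d_2 s ~ d_1 s, for x in X_0 and s in X_2. *)
Inductive pathrel : forall x y, path x y -> path x y -> Prop :=
| pathrel_refl x y (p : path x y) : pathrel p p
| pathrel_sym x y (p q : path x y) : pathrel p q -> pathrel q p
| pathrel_trans x y (p q r : path x y) :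
    pathrel p q -> pathrel q r -> pathrel p r
| pathrel_cat x y z (p p' : path x y) (q q' : path y z) :
    pathrel p p' -> pathrel q q' -> pathrel (pcat p q) (pcat p' q')
| pathrel_degen x (e : edge x x) :
    sval e = act (degen 1) x -> pathrel (pone e) (pnil x)
| pathrel_tri x y z (a : edge x y) (b : edge y z) (c : edge x z) (s : X 2) :
    act face01 s = sval a -> act face12 s = sval b -> act face02 s = sval c ->
    pathrel (pcons a (pone b)) (pone c).

Lemma pathrel_equiv x y : equivalence_rel (@pathrel x y).
Proof.
split; [exact: pathrel_refl|exact: pathrel_sym|exact: pathrel_trans].
Qed.

Definition ho_hom (x y : X 0) : Type := quot (@pathrel x y).

Definition ho_cls x y (p : path x y) : ho_hom x y := cls _ p.

Definition ho_comp x y z (b : ho_hom y z) (a : ho_hom x y) : ho_hom x z :=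
  ho_cls (pcat (repr a) (repr b)).

Lemma ho_clsP x y (p q : path x y) : ho_cls p = ho_cls q <-> pathrel p q.
Proof. exact: (cls_eq (pathrel_equiv x y)). Qed.

Lemma ho_homP x y (a : ho_hom x y) : exists p, a = ho_cls p.
Proof. exact: quotP. Qed.

Lemma repr_ho_cls x y (p : path x y) : pathrel (repr (ho_cls p)) p.
Proof. exact: (repr_cls (pathrel_equiv x y)). Qed.

Lemma ho_comp_cls x y z (q : path y z) (p : path x y) :
  ho_comp (ho_cls q) (ho_cls p) = ho_cls (pcat p q).
Proof. by apply/ho_clsP; apply: pathrel_cat; apply: repr_ho_cls. Qed.

Lemma ho_comp1m x y (a : ho_hom x y) : ho_comp (ho_cls (pnil y)) a = a.
Proof. by have [p ->] := ho_homP a; rewrite ho_comp_cls pcats0. Qed.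

Lemma ho_compm1 x y (a : ho_hom x y) : ho_comp a (ho_cls (pnil x)) = a.
Proof. by have [p ->] := ho_homP a; rewrite ho_comp_cls. Qed.

Lemma ho_compmA x y z t (c : ho_hom z t) (b : ho_hom y z) (a : ho_hom x y) :
  ho_comp c (ho_comp b a) = ho_comp (ho_comp c b) a.
Proof.
have [p ->] := ho_homP a; have [q ->] := ho_homP b; have [r ->] := ho_homP c.
by rewrite !ho_comp_cls pcatA.
Qed.

(* The homotopy category h(X); [ho_nerve_universal] below shows that h is left
   adjoint to the nerve. *)
Definition ho : category :=
  @Category (X 0) ho_hom (fun x => ho_cls (pnil x)) ho_comp
    ho_comp1m ho_compm1 ho_compmA.

Definition ho_edge x y (e : edge x y) : hom (x : ho) y := ho_cls (pone e).

Lemma tarr_ho_edge x y x' y' (e : edge x y) (e' : edge x' y') :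
  sval e = sval e' -> tarr (ho_edge e) = tarr (ho_edge e').
Proof.
case: e e' => [e [ex ey]] [e' [ex' ey']] /= ee'.
case: _ / ee' ex' ey' => ex' ey'.
case: _ / ex ex' => ex'; case: _ / ex'.
case: _ / ey ey' => ey'; case: _ / ey'.
by [].
Qed.

End HomotopyCategory.
Arguments pnil {X} x.

Section HomotopyFunctor.
Variables (X Y : sSet) (F : smap X Y).

Lemma edge_map_proof x y (e : edge x y) :
  src (F 1 (sval e)) = F 0 x /\ tgt (F 1 (sval e)) = F 0 y.
Proof. by case: e => e [ex ey] /=; rewrite -ex -ey /src /tgt !smap_nat. Qed.

Definition edge_map x y (e : edge x y) : edge (F 0 x) (F 0 y) :=
  exist _ (F 1 (sval e)) (edge_map_proof e).

Fixpoint path_map x y (p : path x y) : path (F 0 x) (F 0 y) :=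
  match p in path x y return path (F 0 x) (F 0 y) with
  | pnil x => pnil (F 0 x)
  | pcons _ _ _ e p' => pcons (edge_map e) (path_map p')
  end.

Lemma path_map_cat x y z (p : path x y) (q : path y z) :
  path_map (pcat p q) = pcat (path_map p) (path_map q).
Proof. by elim: p q => //= {}x {}y w e p IH q; rewrite IH. Qed.

Lemma path_map_rel x y (p q : path x y) :
  pathrel p q -> pathrel (path_map p) (path_map q).
Proof.
elim=> {x y p q}.
- by move=> *; apply: pathrel_refl.
- by move=> *; apply: pathrel_sym.
- by move=> x y p q r _ pq _ qr; apply: pathrel_trans pq qr.
- by move=> *; rewrite !path_map_cat; apply: pathrel_cat.
- by move=> x e ex; apply: pathrel_degen; rewrite /= ex smap_nat.
- move=> x y z a b c s sa sb sc.
  by apply: (@pathrel_tri _ _ _ _ _ _ _ (F 2 s)); rewrite /= -smap_nat ?sa ?sb ?sc.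
Qed.

Definition ho_fun x y (a : ho_hom x y) : ho_hom (F 0 x) (F 0 y) :=
  ho_cls (path_map (repr a)).

Lemma ho_fun_cls x y (p : path x y) : ho_fun (ho_cls p) = ho_cls (path_map p).
Proof. by apply/ho_clsP; apply: path_map_rel; apply: repr_ho_cls. Qed.

Lemma ho_fun1 x : ho_fun (ho_cls (pnil x)) = ho_cls (pnil (F 0 x)).
Proof. by rewrite ho_fun_cls. Qed.

Lemma ho_funM x y z (b : ho_hom y z) (a : ho_hom x y) :
  ho_fun (ho_comp b a) = ho_comp (ho_fun b) (ho_fun a).
Proof.
have [p ->] := ho_homP a; have [q ->] := ho_homP b.
by rewrite ho_comp_cls !ho_fun_cls ho_comp_cls path_map_cat.
Qed.

Definition ho_map : functor (ho X) (ho Y) :=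
  @Functor (ho X) (ho Y) (F 0) ho_fun ho_fun1 ho_funM.

End HomotopyFunctor.

Section Unit.
Variables (X : sSet) (n : nat) (x : X n).

Definition uvert (i : 'I_n.+1) : X 0 := act (vert i) x.

Lemma uedge_proof (i j : 'I_n.+1) (ij : i <= j) :
  src (act (edge_op ij) x) = uvert i /\ tgt (act (edge_op ij) x) = uvert j.
Proof.
by rewrite /src /tgt -!act_comp; split; congr act; apply: mono_ext.
Qed.

Definition uedge (i j : 'I_n.+1) (ij : i <= j) : edge (uvert i) (uvert j) :=
  exist _ (act (edge_op ij) x) (uedge_proof ij).

Lemma tri_op_mono (i j k : 'I_n.+1) (ij : i <= j) (jk : j <= k) (a b : 'I_3) :
  a <= b -> tnth [tuple i; j; k] a <= tnth [tuple i; j; k] b.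
Proof.
have ik := leq_trans ij jk.
case: a b => [[|[|[|//]]] ?] [[|[|[|//]]] ?] //= _;
by rewrite !(tnth_nth ord0).
Qed.

Definition tri_op (i j k : 'I_n.+1) (ij : i <= j) (jk : j <= k) : mono 2 n :=
  @Mono 2 n (tnth [tuple i; j; k]) (tri_op_mono ij jk).

Lemma unit_id (i : 'I_n.+1) : ho_edge (uedge (leqnn i)) = @idm (ho X) (uvert i).
Proof.
apply/ho_clsP/pathrel_degen => /=.
rewrite /uvert -act_comp; congr act; apply: mono_ext => k /=.
by case: ifP.
Qed.

Lemma unit_comp (i j k : 'I_n.+1) (jk : j <= k) (ij : i <= j) :
  ho_edge (uedge (leq_trans ij jk)) =
  comp (ho_edge (uedge jk)) (ho_edge (uedge ij)).
Proof.
rewrite /= ho_comp_cls; apply/esym/ho_clsP.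
apply: (@pathrel_tri _ _ _ _ _ _ _ (act (tri_op ij jk) x)) => /=;
  rewrite -act_comp; congr act; apply: mono_ext => a;
  by rewrite /= (tnth_nth ord0); case: ifP.
Qed.

Definition unit_simplex : functor (ordc n) (ho X) :=
  @Functor (ordc n) (ho X) uvert (fun i j ij => ho_edge (uedge ij))
    unit_id unit_comp.

End Unit.

Lemma unit_nat (X : sSet) m n (t : mono m n) (x : X n) :
  unit_simplex (act t x) = act (s:=nerve (ho X)) t (unit_simplex x).
Proof.
apply: functor_ext => i j ij /=.
apply: tarr_ho_edge => /=; rewrite -act_comp; congr act.
by apply: mono_ext => k /=; case: ifP.
Qed.

Definition ho_unit (X : sSet) : smap X (nerve (ho X)) :=
  @SMap X (nerve (ho X)) (fun n x => unit_simplex x) (@unit_nat X).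

Section Adjunction.
Variables (X : sSet) (C : category) (F : smap X (nerve C)).

Let arr01 (G : nerve C 1) : hom ((G : functor _ _) ord0) ((G : functor _ _) ord_max) :=
  fhom (G : functor (ordc 1) C) (x:=ord0) (y:=ord_max) isT.

Let Fob (x : ho X) : C := (F 0 x : functor (ordc 0) C) ord0.

Lemma Fob_act n (x : X n) i : (F n x : functor _ _) i = Fob (act (vert i) x).
Proof. by rewrite /Fob smap_nat. Qed.

Lemma Fsrc x y (e : edge x y) : (F 1 (sval e) : functor _ _) ord0 = Fob x.
Proof. by case: e => e [ex ey] /=; rewrite -ex; apply: Fob_act. Qed.

Lemma Ftgt x y (e : edge x y) : (F 1 (sval e) : functor _ _) ord_max = Fob y.
Proof. by case: e => e [ex ey] /=; rewrite -ey; apply: Fob_act. Qed.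

Let Fedge x y (e : edge x y) : hom (Fob x) (Fob y) :=
  hcast (Fsrc e) (Ftgt e) (arr01 (F 1 (sval e))).

Let tarr_Fedge x y (e : edge x y) : tarr (Fedge e) = tarr (arr01 (F 1 (sval e))).
Proof. exact: tarr_hcast. Qed.

Let tarr_Fact n (x : X n) (i j : 'I_n.+1) (ij : i <= j) :
  tarr (arr01 (F 1 (act (edge_op ij) x))) =
  tarr (fhom (F n x : functor (ordc n) C) (x:=i) (y:=j) ij).
Proof.
rewrite smap_nat /arr01 /=.
by congr (tarr (fhom (F n x : functor (ordc n) C) _)); apply: ordc_irr.
Qed.

Fixpoint Fpath x y (p : path x y) : hom (Fob x) (Fob y) :=
  match p in path x y return hom (Fob x) (Fob y) with
  | pnil x => idm (Fob x)
  | pcons _ _ _ e p' => comp (Fpath p') (Fedge e)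
  end.

Lemma Fpath_cat x y z (p : path x y) (q : path y z) :
  Fpath (pcat p q) = comp (Fpath q) (Fpath p).
Proof.
elim: p q => /= [{}x|{}x {}y w e p IH] q; first by rewrite compm1.
by rewrite IH compmA.
Qed.

Lemma Fpath_rel x y (p q : path x y) : pathrel p q -> Fpath p = Fpath q.
Proof.
elim=> {x y p q} //=.
- by move=> x y p q r _ -> _ ->.
- by move=> x y z p p' q q' _ ep _ eq; rewrite !Fpath_cat ep eq.
- move=> x e ex; rewrite comp1m; apply: tarr_inj; rewrite tarr_Fedge ex.
  rewrite smap_nat /arr01 /= -/(Fob x) -fhom1.
  by congr (tarr (fhom (F 0 x : functor (ordc 0) C) _)); apply: ordc_irr.
- move=> x y z a b c s sa sb sc; rewrite !comp1m; apply: tarr_inj.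
  rewrite tarr_Fedge -sc tarr_Fact.
  rewrite (_ : tarr _ = tarr (comp
    (fhom (F 2 s : functor (ordc 2) C) (x:=@Ordinal 3 1 isT) (y:=@Ordinal 3 2 isT) isT)
    (fhom (F 2 s : functor (ordc 2) C) (x:=@Ordinal 3 0 isT) (y:=@Ordinal 3 1 isT) isT))).
    rewrite -fhomM.
    by congr (tarr (fhom (F 2 s : functor (ordc 2) C) _)); apply: ordc_irr.
  by apply: tarr_comp; rewrite tarr_Fedge -(sa, sb) tarr_Fact.
Qed.

Let Fhom x y (a : ho_hom x y) : hom (Fob x) (Fob y) := Fpath (repr a).

Let Fhom_cls x y (p : path x y) : Fhom (ho_cls p) = Fpath p.
Proof. by apply: Fpath_rel; apply: repr_ho_cls. Qed.

Let Fhom1 x : Fhom (ho_cls (pnil x)) = idm (Fob x).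
Proof. by rewrite Fhom_cls. Qed.

Let FhomM x y z (b : ho_hom y z) (a : ho_hom x y) :
  Fhom (ho_comp b a) = comp (Fhom b) (Fhom a).
Proof.
have [p ->] := ho_homP a; have [q ->] := ho_homP b.
by rewrite ho_comp_cls !Fhom_cls Fpath_cat.
Qed.

Let Ftr : functor (ho X) C := @Functor (ho X) C Fob Fhom Fhom1 FhomM.

Let FtrP : nerve_map Ftr ∘ ho_unit X = F.
Proof.
apply: smap_ext => n x; apply: functor_ext => i j ij /=.
by rewrite Fhom_cls /= comp1m tarr_Fedge tarr_Fact.
Qed.

Let Ftr_uniq (G G' : functor (ho X) C) :
  nerve_map G ∘ ho_unit X = nerve_map G' ∘ ho_unit X -> G = G'.
Proof.
move=> e; apply: functor_ext => x y a.
have {a} [p ->] := ho_homP a.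
have en n (z : X n) : fcomp G (unit_simplex z) = fcomp G' (unit_simplex z).
  exact: (congr1 (fun f : smap X (nerve C) => f n z) e).
elim: p => {x y} [x|x y z ed p IH].
  have -> : ho_cls (pnil x) = @idm (ho X) x by [].
  rewrite !fhom1; apply: tarr_idm.
  have := congr1 (fun f : functor (ordc 0) C => f ord0) (en 0 x).
  rewrite /= /uvert (_ : vert _ = mono_id 0) ?act_id //.
  by apply: mono_ext => i; rewrite /= ord1.
have -> : ho_cls (pcons ed p) = @comp (ho X) _ _ _ (ho_cls p) (ho_edge ed).
  by rewrite /= ho_comp_cls.
rewrite !fhomM; apply: tarr_comp IH.
have le01 : (ord0 : 'I_2) <= (ord_max : 'I_2) by [].
have ee : tarr (ho_edge ed) = tarr (ho_edge (uedge (sval ed) le01)).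
  apply: tarr_ho_edge => /=.
  rewrite (_ : edge_op _ = mono_id 1) ?act_id //.
  by apply: mono_ext => i; apply: val_inj; case: i => [[|[|//]] ?].
rewrite (tarr_fhom G ee) (tarr_fhom G' ee).
exact: (functor_eq_arr (x:=ord0 : ordc 1) (y:=ord_max) le01 (en 1 (sval ed))).
Qed.

Theorem ho_nerve_universal :
  exists! G : functor (ho X) C, nerve_map G ∘ ho_unit X = F.
Proof.
by exists Ftr; split=> [|G GF]; [exact: FtrP|apply: Ftr_uniq; rewrite FtrP GF].
Qed.

End Adjunction.

Lemma ho_unit_nat (X Y : sSet) (F : smap X Y) :
  nerve_map (ho_map F) ∘ ho_unit X = ho_unit Y ∘ F.
Proof.
apply: smap_ext => n x; apply: functor_ext => i j ij /=.
rewrite ho_fun_cls; apply: (@tarr_ho_edge Y _ _ _ _ (edge_map F (uedge x ij))).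
by rewrite /= smap_nat.
Qed.

(* qCat_2 is the full sub-2-category, on the quasi-categories, of the
   2-category of simplicial sets with hom-categories h(B^A).  Its 1-cells are
   simplicial maps, identified with the objects of h(B^A) by [vtx]. *)

Definition cell (A B : sSet) (f g : smap A B) : Type :=
  @hom (ho (sexp B A)) (vtx f) (vtx g).

Definition cid (A B : sSet) (f : smap A B) : cell f f :=
  @idm (ho (sexp B A)) (vtx f).

Definition vcomp (A B : sSet) (f g h : smap A B) (b : cell g h) (a : cell f g) :
  cell f h := @comp (ho (sexp B A)) _ _ _ b a.

Definition ccast (A B : sSet) (f f' g g' : smap A B) (ef : f = f') (eg : g = g')
    (a : cell f g) : cell f' g' :=
  @hcast (ho (sexp B A)) _ _ _ _
    (congr1 (@vtx B A) ef) (congr1 (@vtx B A) eg) a.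

(* Equality of 2-cells whose boundaries are only propositionally equal. *)
Definition ceq (A B : sSet) (f f' g g' : smap A B) (a : cell f g)
    (a' : cell f' g') : Prop :=
  exists (ef : f = f') (eg : g = g'), ccast ef eg a = a'.

Lemma vtx_pre (X A B : sSet) (f : smap A B) (k : smap X A) :
  sexp_pre B k 0 (vtx f) = vtx (f ∘ k).
Proof. exact: smap_ext. Qed.

Lemma vtx_post (A B D : sSet) (h : smap B D) (f : smap A B) :
  sexp_post A h 0 (vtx f) = vtx (h ∘ f).
Proof. exact: smap_ext. Qed.

Definition whiskr (X A B : sSet) (f g : smap A B) (a : cell f g)
    (k : smap X A) : cell (f ∘ k) (g ∘ k) :=
  @hcast (ho (sexp B X)) _ _ _ _ (vtx_pre f k) (vtx_pre g k)
    (fhom (ho_map (sexp_pre B k)) a).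

Definition whiskl (A B D : sSet) (h : smap B D) (f g : smap A B)
    (a : cell f g) : cell (h ∘ f) (h ∘ g) :=
  @hcast (ho (sexp D A)) _ _ _ _ (vtx_post h f) (vtx_post h g)
    (fhom (ho_map (sexp_post A h)) a).

Lemma whiskl_id (A B D : sSet) (h : smap B D) (f : smap A B) :
  whiskl h (cid f) = cid (h ∘ f).
Proof. by rewrite /whiskl /cid fhom1 hcast_idm. Qed.

Lemma whiskl_comp (A B D : sSet) (h : smap B D) (f g k : smap A B)
    (b : cell g k) (a : cell f g) :
  whiskl h (vcomp b a) = vcomp (whiskl h b) (whiskl h a).
Proof.
rewrite /whiskl /vcomp fhomM.
exact: (@hcast_comp (ho _) _ _ _ _ _ _ (vtx_post h f) (vtx_post h g) (vtx_post h k)).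
Qed.

Lemma whiskr_id (X A B : sSet) (f : smap A B) (k : smap X A) :
  whiskr (cid f) k = cid (f ∘ k).
Proof. by rewrite /whiskr /cid fhom1 hcast_idm. Qed.

Lemma whiskr_comp (X A B : sSet) (f g h : smap A B) (b : cell g h)
    (a : cell f g) (k : smap X A) :
  whiskr (vcomp b a) k = vcomp (whiskr b k) (whiskr a k).
Proof.
rewrite /whiskr /vcomp fhomM.
exact: (@hcast_comp (ho _) _ _ _ _ _ _ (vtx_pre f k) (vtx_pre g k) (vtx_pre h k)).
Qed.

Lemma ceq_tarr (A B : sSet) (f f' g g' : smap A B) (a : cell f g)
    (a' : cell f' g') : ceq a a' <-> tarr a = tarr a'.
Proof.
split=> [[ef [eg <-]]|/tarrP[ef [eg e]]]; first by rewrite tarr_hcast.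
have ef' := bij_inj (vtx_bij B A) ef; have eg' := bij_inj (vtx_bij B A) eg.
exists ef', eg'; rewrite -e /ccast.
by congr hcast; apply: Prop_irrelevance.
Qed.

Definition iso1cells (A B : sSet) (f g : smap A B) : Prop :=
  @isomorphic (ho (sexp B A)) (vtx f) (vtx g).

Definition equivalence (E F : sSet) (w : smap E F) : Prop :=
  exists v : smap F E, iso1cells (v ∘ w) (sid E) /\ iso1cells (w ∘ v) (sid F).

Section Slice.
Variables (Z E F : sSet) (u : smap E Z) (v : smap F Z).

Definition slice1 : Type := {w : smap E F | v ∘ w = u}.

Definition slice2 (w w' : slice1) : Type :=
  {a : cell (sval w) (sval w') | ceq (whiskl v a) (cid u)}.

Lemma slice_id_proof (w : slice1) : ceq (whiskl v (cid (sval w))) (cid u).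
Proof.
by apply/ceq_tarr; rewrite whiskl_id; apply: tarr_idm; rewrite (svalP w).
Qed.

Lemma slice_comp_proof (w w' w'' : slice1) (b : slice2 w' w'')
  (a : slice2 w w') : ceq (whiskl v (vcomp (sval b) (sval a))) (cid u).
Proof.
have /ceq_tarr aP := svalP a; have /ceq_tarr bP := svalP b.
apply/ceq_tarr; rewrite whiskl_comp; apply: (etrans (tarr_comp aP bP)).
by rewrite comp1m.
Qed.

Definition slice_id (w : slice1) : slice2 w w :=
  exist (fun a => ceq (whiskl v a) (cid u)) _ (slice_id_proof w).

Definition slice_comp (w w' w'' : slice1) (b : slice2 w' w'')
    (a : slice2 w w') : slice2 w w'' :=
  exist (fun a => ceq (whiskl v a) (cid u)) _ (slice_comp_proof b a).

Lemma slice_comp1m w w' (a : slice2 w w') : slice_comp (slice_id w') a = a.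
Proof. by apply: sval_inj; apply: comp1m. Qed.

Lemma slice_compm1 w w' (a : slice2 w w') : slice_comp a (slice_id w) = a.
Proof. by apply: sval_inj; apply: compm1. Qed.

Lemma slice_compmA w w' w'' w''' (c : slice2 w'' w''') (b : slice2 w' w'')
    (a : slice2 w w') :
  slice_comp c (slice_comp b a) = slice_comp (slice_comp c b) a.
Proof. by apply: sval_inj; apply: compmA. Qed.

(* The hom-category from [u] to [v] of the slice 2-category over [Z]. *)
Definition slice_hom : category :=
  @Category slice1 slice2 slice_id slice_comp
    slice_comp1m slice_compm1 slice_compmA.

End Slice.

Section Evaluation.
Variable A : sSet.

Lemma ev_nat (i : 'I_2) m n (t : mono m n) (u : sexp A (simp 1) n) :
  (act t u : smap _ _) m (mono_id m, mono_comp (vert i) (degen m)) =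
  act t ((u : smap _ _) n (mono_id n, mono_comp (vert i) (degen n))).
Proof. by rewrite -smap_nat. Qed.

Definition ev (i : 'I_2) : smap (sexp A (simp 1)) A :=
  @SMap (sexp A (simp 1)) A
    (fun n (u : smap _ _) => u n (mono_id n, mono_comp (vert i) (degen n)))
    (@ev_nat i).

Definition dom : smap (sexp A (simp 1)) A := ev ord0.
Definition cod : smap (sexp A (simp 1)) A := ev ord_max.

End Evaluation.

Section Transpose.
Variables (Z K A : sSet) (H : smap Z (sexp A K)).

Lemma transpose_nat m n (t : mono m n) (x : sprod K Z n) :
  (H m (act t x).2 : smap _ _) m (mono_id m, (act t x).1) =
  act t ((H n x.2 : smap _ _) n (mono_id n, x.1)).
Proof. by rewrite -smap_nat /= smap_nat. Qed.

Definition transpose : smap (sprod K Z) A :=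
  @SMap (sprod K Z) A
    (fun n x => (H n x.2 : smap _ _) n (mono_id n, x.1)) transpose_nat.

End Transpose.

Section ArrowCell.
Variables (Z A : sSet) (H : smap Z (sexp A (simp 1))) (f g : smap Z A).
Hypotheses (Hdom : dom A ∘ H = f) (Hcod : cod A ∘ H = g).

Lemma arrow_edge_proof :
  src (X:=sexp A Z) (transpose H) = vtx f /\
  tgt (X:=sexp A Z) (transpose H) = vtx g.
Proof.
rewrite -Hdom -Hcod; split; apply: smap_ext => n [x z] /=;
  congr ((H n z : smap _ _) n (_, _)); exact: mono_ext.
Qed.

(* The transpose of H : Z -> A^(Delta^1) is a 1-simplex of A^Z; it represents a
   2-cell. *)
Definition arrow_cell : cell f g :=
  ho_edge (exist _ (transpose H : sexp A Z 1) arrow_edge_proof).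

End ArrowCell.

(* [comma1], [comma0] and [comma_cell] are the projections q_1, q_0 of the comma
   object and its canonical 2-cell psi : f q_0 => g q_1. *)
Section Comma.
Variables (A B C : sSet) (f : smap B A) (g : smap C A).

Definition comma : sSet := spull (spair (cod A) (dom A)) (sprodmap g f).

Definition comma_arr : smap comma (sexp A (simp 1)) := spull1 _ _.
Definition comma1 : smap comma C := sfst C B ∘ spull2 _ _.
Definition comma0 : smap comma B := ssnd C B ∘ spull2 _ _.

Lemma comma_dom : dom A ∘ comma_arr = f ∘ comma0.
Proof.
have /(congr1 (scomp (ssnd A A))) := spull_sq (spair (cod A) (dom A)) (sprodmap g f).
by move=> e; apply: smap_ext => n x; exact: (congr1 (fun h : smap comma A => h n x) e).
Qed.

Lemma comma_cod : cod A ∘ comma_arr = g ∘ comma1.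
Proof.
have /(congr1 (scomp (sfst A A))) := spull_sq (spair (cod A) (dom A)) (sprodmap g f).
by move=> e; apply: smap_ext => n x; exact: (congr1 (fun h : smap comma A => h n x) e).
Qed.

Definition comma_cell : cell (f ∘ comma0) (g ∘ comma1) :=
  arrow_cell comma_dom comma_cod.

End Comma.

Section Lifting.
Variables (A B C : sSet) (f : smap B A) (g : smap C A) (l : smap C B).

(* The pasting  lam c . f zeta  :  f b => f l c => g c. *)
Definition paste (lam : cell (f ∘ l) g) (X : sSet) (b : smap X B) (c : smap X C)
    (zeta : cell b (l ∘ c)) : cell (f ∘ b) (g ∘ c) :=
  vcomp (ccast (scompA f l c) erefl (whiskr lam c)) (whiskl f zeta).

Definition absolute_right_lifting (lam : cell (f ∘ l) g) : Prop :=
  forall X : sSet, quasicategory X ->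
  forall (b : smap X B) (c : smap X C) (chi : cell (f ∘ b) (g ∘ c)),
  exists! zeta : cell b (l ∘ c), chi = paste lam zeta.

(* The canonical 2-cell phi : p_0 => l p_1 of B \downarrow l; [comma_cell] has
   domain id_B p_0. *)
Definition comma_cell1 : cell (comma0 (sid B) l) (l ∘ comma1 (sid B) l) :=
  ccast (scomp1s _) erefl (comma_cell (sid B) l).

Definition induces (lam : cell (f ∘ l) g)
    (w : smap (comma (sid B) l) (comma f g)) : Prop :=
  [/\ comma0 f g ∘ w = comma0 (sid B) l,
      comma1 f g ∘ w = comma1 (sid B) l &
      ceq (whiskr (comma_cell f g) w) (paste lam comma_cell1)].

(* The hom-category of qCat_2 / (C x B) from (p_1, p_0) to (q_1, q_0). *)
Definition comma_slice_hom : category :=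
  slice_hom (spair (comma1 (sid B) l) (comma0 (sid B) l))
            (spair (comma1 f g) (comma0 f g)).

Lemma induces_slice lam w : induces lam w ->
  spair (comma1 f g) (comma0 f g) ∘ w =
  spair (comma1 (sid B) l) (comma0 (sid B) l).
Proof. by case=> e0 e1 _; rewrite -e0 -e1; apply: smap_ext. Qed.

Definition induced_slice1 lam w (h : induces lam w) : comma_slice_hom :=
  exist _ w (induces_slice h).

Definition slice1_map (w : comma_slice_hom) :
  smap (comma (sid B) l) (comma f g) := sval w.

End Lifting.

(* Main.v *)
(* Inner horns of [A^X], and of the comma objects, are filled directly: a
   partial map on [Delta^n x X] defined on [Lambda^n_k x X] and on [Delta^n x P]
   is extended, by Zorn's lemma, one simplex at a time.  A simplex [(t, x)] is
   paired with the one obtained by inserting the value [k] just before [t] first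
   exceeds [k]; attaching the pair amounts to filling an inner horn.

   Given this, 2-cells between quasi-categories are homotopy classes of edges,
   a 2-cell [f b => g c] lifts to a functor [a] into the comma object, and [a]
   is unique up to an isomorphism over [C x B].  Hence [lambda |-> w] is well
   defined.  For bijectivity, [p_1] has a section [i] with [phi i = id] and a
   2-cell [nu : id => i p_1] with [p_0 nu = phi], [p_1 nu = id]: restriction
   along [i] recovers [lambda] from [psi w], and interchange of [nu] with
   [psi w] gives [psi w = lambda p_1 . f phi] for [lambda := psi w i].

   If [lambda] is an absolute lifting, factoring [psi] through it gives a functor
   inverse to [w].  Conversely, if [e : w v ~ id], then
   [l q_1 e . phi v . (q_0 e)^-1] factors [psi], whence existence, and
   uniqueness holds since composition with [w] is full. *)
Require Import Defs.
From mathcomp Require Import boolp classical_sets.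
From mathcomp Require Import all_boot zify.
Set Implicit Arguments.
Unset Strict Implicit.
Unset Printing Implicit Defensive.
Local Open Scope qcat_scope.

(** * Monotone maps and horns *)

Lemma delta_mono n (i : 'I_n.+2) (a b : 'I_n.+1) :
  a <= b -> lift i a <= lift i b.
Proof. by rewrite /= /bump; lia. Qed.

Definition delta n (i : 'I_n.+2) : mono n n.+1 :=
  @Mono n n.+1 (lift i) (@delta_mono n i).

Lemma sigma_proof n (j : 'I_n.+1) (i : 'I_n.+2) : unbump j i < n.+1.
Proof. by rewrite /unbump; have := ltn_ord i; have := ltn_ord j; lia. Qed.

Lemma sigma_mono n (j : 'I_n.+1) (a b : 'I_n.+2) :
  a <= b -> Ordinal (sigma_proof j a) <= Ordinal (sigma_proof j b).
Proof. by rewrite /= /unbump; lia. Qed.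

Definition sigma n (j : 'I_n.+1) : mono n.+1 n :=
  @Mono n.+1 n (fun i => Ordinal (sigma_proof j i)) (@sigma_mono n j).

Section Insertion.
Variables (n : nat) (k : 'I_n.+1).

Lemma ins_mono d (j : 'I_d.+1) (t : mono d n) (a b : 'I_d.+2) : a <= b ->
  (if (a <= j) && (k < t (sigma j a)) then k else t (sigma j a)) <=
  (if (b <= j) && (k < t (sigma j b)) then k else t (sigma j b)).
Proof.
move=> ab; have := monoP t (monoP (sigma j) ab).
by case: ifP; case: ifP; lia.
Qed.

(* When [j] is the first index at which [t] exceeds [k], [ins j t] is [t] with
   the value [k] inserted at position [j]. *)
Definition ins d (j : 'I_d.+1) (t : mono d n) : mono d.+1 n :=
  @Mono d.+1 n (fun i => if (i <= j) && (k < t (sigma j i)) then k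
                         else t (sigma j i)) (@ins_mono d j t).

Definition first_above d (t : mono d n) (j : 'I_d.+1) : Prop :=
  forall i, (t i <= k) = (i < j).

Lemma first_above_ge d (t : mono d n) (j : 'I_d.+1) : first_above t j -> k < t j.
Proof. by move/(_ j); rewrite ltnn ltnNge => ->. Qed.

Lemma first_above_exists d (t : mono d n) (i : 'I_d.+1) :
  k < t i -> exists j, first_above t j.
Proof.
move=> ki; exists [arg min_(j < i | k < t j) j] => a.
case: arg_minnP => // j kj jmin.
apply/idP/idP => [ta|]; first by rewrite ltnNge; apply/negP => /(monoP t); lia.
by move=> aj; rewrite leqNgt; apply/negP => /jmin; rewrite leqNgt aj.
Qed.

Lemma ins_eq d (j : 'I_d.+1) (t : mono d n) (i : 'I_d.+2) :
  first_above t j -> i = j :> nat -> ins j t i = k.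
Proof.
move=> tj ij; rewrite /= (_ : Ordinal _ = j).
  by rewrite (first_above_ge tj) ij leqnn.
by apply: val_inj; rewrite /= /unbump; lia.
Qed.

Lemma ins_neq d (j : 'I_d.+1) (t : mono d n) (i : 'I_d.+2) :
  first_above t j -> i <> j :> nat -> ins j t i = t (sigma j i).
Proof.
move=> tj ij /=; case: ifP => // /andP[le lt].
have := tj (Ordinal (sigma_proof j i)); rewrite leqNgt lt /= /unbump.
lia.
Qed.

End Insertion.

Lemma sigma_delta n (j : 'I_n.+1) (i : 'I_n.+2) :
  i = j :> nat \/ i = j.+1 :> nat -> mono_comp (sigma j) (delta i) = mono_id n.
Proof.
move=> ij; apply: mono_ext => a; apply: val_inj => /=.
by rewrite /unbump /bump; case: ij => ->; lia.
Qed.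

Lemma strict_mono_lt d (s : mono d d) (i j : 'I_d.+1) :
  injective s -> i < j -> s i < s j.
Proof.
move=> si ij; rewrite ltn_neqAle monoP ?(ltnW ij) // andbT.
by apply/eqP => /val_inj/si e; rewrite e ltnn in ij.
Qed.

Lemma strict_mono_ge d (s : mono d d) (a : 'I_d.+1) : injective s -> a <= s a.
Proof.
move=> si; have lt i j := @strict_mono_lt d s i j si.
suff: forall m (md : m < d.+1), m <= s (Ordinal md).
  by move/(_ _ (ltn_ord a)); rewrite (_ : Ordinal _ = a) //; apply: val_inj.
elim=> // m IH md; have md' : m < d.+1 by lia.
have := IH md'; have := lt (Ordinal md') (Ordinal md); rewrite /=; lia.
Qed.

Lemma strict_mono_id d (s : mono d d) : injective s -> s = mono_id d.
Proof.
move=> si; have lt i j := @strict_mono_lt d s i j si.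
apply: mono_ext => a; apply: val_inj; apply/eqP.
rewrite eqn_leq strict_mono_ge // andbT /=.
(* The upper bound is the dual induction, run downwards from the last vertex. *)
suff: forall m (md : m < d.+1), m + s (rev_ord (Ordinal md)) <= d.
  move=> /(_ _ (ltn_ord (rev_ord a))).
  rewrite (_ : rev_ord (Ordinal _) = a); last first.
    by apply: val_inj => /=; have := ltn_ord a; lia.
  by rewrite /=; have := ltn_ord a; lia.
elim=> [|m IH] md; first by rewrite -ltnS ltn_ord.
have md' : m < d.+1 by lia.
apply: leq_trans (IH md'); rewrite addSn -addnS leq_add2l.
by apply: lt => /=; lia.
Qed.

(** Preimages chosen pointwise are automatically monotone: a reversal would make two values of the
    injective [v] coincide. Prescribing the preimage of [v i0] allows [free] and [free_surj] to
    compare two maps at an arbitrary point. *)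
Lemma mono_section q r m (u : mono r m) (v : mono q m) (i0 : 'I_q.+1)
    (a0 : 'I_r.+1) : injective v -> (forall i, exists a, u a = v i) ->
  u a0 = v i0 -> exists s : mono q r, mono_comp u s = v /\ s i0 = a0.
Proof.
move=> vi uv e0.
have /choice[s sP] : forall i, exists a, u a = v i /\ (i = i0 -> a = a0).
  move=> i; have [->|ne] := eqVneq i i0; first by exists a0.
  by have [a ea] := uv i; exists a; split=> // e; rewrite e eqxx in ne.
have sm (i j : 'I_q.+1) : i <= j -> s i <= s j.
  move=> ij; rewrite leqNgt; apply/negP => ji.
  have := monoP u (ltnW ji); rewrite !(proj1 (sP _)) => vji.
  have : v i = v j by apply: val_inj; apply/eqP; rewrite eqn_leq vji monoP.
  by move/vi => e; rewrite e ltnn in ji.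
exists (Mono sm); split; last by have [_ /(_ erefl)] := sP i0.
by apply: mono_ext => i; have [] := sP i.
Qed.

(** The section of [u] over [v] is an injective endomap of [q], hence the identity. *)
Lemma mono_cover q m (u v : mono q m) : injective v ->
  (forall i, exists a, u a = v i) -> u = v.
Proof.
move=> vi uv; have [a e] := uv ord0.
have [s [us _]] := mono_section vi uv e.
suff s1 : s = mono_id q by rewrite -us s1; apply: mono_ext.
by apply: strict_mono_id => x y e'; apply: vi; rewrite -us /= e'.
Qed.

Lemma ord_neq n (x y : 'I_n) : x != y -> x <> y :> nat.
Proof. by move=> /eqP ne /val_inj. Qed.

Lemma in_horn_delta d r (j : 'I_d.+2) (u : simp d.+1 r) : in_horn j u ->
  exists (i : 'I_d.+2) (s : mono r d), i != j /\ u = mono_comp (delta i) s.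
Proof.
move=> [i [ij ui]].
have lt (a : 'I_r.+1) : unbump i ((u : mono _ _) a) < d.+1.
  have ne := ord_neq (ui a).
  have := ltn_ord ((u : mono _ _) a); have := ltn_ord i; rewrite /unbump; lia.
have sm (a b : 'I_r.+1) : a <= b -> Ordinal (lt a) <= Ordinal (lt b).
  by move/(monoP u) => /=; rewrite /unbump; lia.
exists i, (Mono sm); split=> //; apply: mono_ext => a; apply: val_inj => /=.
have ne := ord_neq (ui a).
by rewrite /unbump /bump; lia.
Qed.

Lemma not_in_horn m r (j : 'I_m.+1) (u : simp m r) : ~ in_horn j u ->
  forall i, i != j -> exists a, (u : mono _ _) a = i.
Proof.
move=> h i ij; apply: contrapT => no; apply: h; exists i; split=> // a.
by apply/eqP => e; apply: no; exists a.
Qed.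

(** * Extension from an inner horn times a simplicial set *)

Section PartialMaps.
Variables Y A : sSet.

(** A map defined on a simplicial subset, encoded as a functional relation so that the union of a
    chain is a mere disjunction. *)
Record pmap := PMap {
  graph :> forall n, Y n -> A n -> Prop;
  graph_act : forall m n (t : mono m n) (y : Y n) (a : A n),
    graph y a -> graph (act t y) (act t a);
  graph_fun : forall n (y : Y n) (a b : A n), graph y a -> graph y b -> a = b }.

Definition pdom (G : pmap) n (y : Y n) : Prop := exists a, G n y a.

Lemma pdom_act (G : pmap) m n (t : mono m n) (y : Y n) :
  pdom G y -> pdom G (act t y).
Proof. by move=> [a ya]; exists (act t a); apply: graph_act. Qed.

Definition pincl (G G' : pmap) : Prop := forall n (y : Y n) a, G n y a -> G' n y a.

Definition extends (s : smap Y A) (G : pmap) : Prop :=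
  forall n (y : Y n) a, G n y a -> s n y = a.

Lemma total_extends (G : pmap) : (forall n (y : Y n), pdom G y) ->
  exists s, extends s G.
Proof.
move=> /(_ _ _)/boolp.cid tot.
have nat m n (t : mono m n) (y : Y n) :
    sval (tot _ (act t y)) = act t (sval (tot _ y)).
  by apply: graph_fun (svalP (tot _ _)) _; apply: graph_act (svalP (tot _ _)).
exists (SMap nat) => n y a; exact: graph_fun (svalP (tot _ _)).
Qed.

Variable K : forall m n, Y m -> Y n -> Prop.

Definition kclosed (G : pmap) : Prop :=
  forall m n (y : Y m) (z : Y n), K y z -> pdom G y -> pdom G z.

Lemma pmap_extend (G0 : pmap) : kclosed G0 ->
  (forall G, pincl G0 G -> kclosed G -> forall n (y : Y n), ~ pdom G y ->
     exists G', [/\ pincl G G', kclosed G' & ~ pincl G' G]) ->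
  exists s, extends s G0.
Proof.
move=> K0 step.
pose P G := pincl G0 G /\ kclosed G; pose T := {G | P G}.
have t0 : T by exists G0; split.
pose R (s t : T) := `[< pincl (sval s) (sval t) >].
have [|||[G [G0G KG]] Gmax] := @ZL_preorder T t0 R.
- by move=> t; apply/asboolP => ?.
- by move=> r s t /asboolP rs /asboolP st; apply/asboolP => n y a /rs/st.
- move=> S Stot.
  (* [G0] is adjoined explicitly so that the empty chain also has an upper bound. *)
  pose U n (y : Y n) a := G0 n y a \/ exists2 G : T, S G & sval G n y a.
  have Uact m n (t : mono m n) y a : U n y a -> U m (act t y) (act t a).
    move=> [h|[G SG h]]; first by left; apply: graph_act.
    by right; exists G => //; apply: graph_act.
  have Ufun n (y : Y n) a b : U n y a -> U n y b -> a = b.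
    have GG0 (G : T) : G0 n y a -> sval G n y b -> a = b.
      by case: G => G [inc kG] /= /inc; apply: graph_fun.
    have GG0' (G : T) : sval G n y a -> G0 n y b -> a = b.
      by case: G => G [inc kG] /= h /inc; apply: graph_fun.
    move=> [h|[G SG h]] [h'|[G' SG' h']]; [exact: graph_fun h h'|exact: GG0 h h'|
      exact: GG0' h h'|].
    by have [/asboolP i|/asboolP i] := Stot _ _ SG SG';
      [exact: graph_fun (i _ _ _ h) h'|exact: graph_fun h (i _ _ _ h')].
  have tP : P (PMap Uact Ufun).
    split; first by move=> n y a; left.
    move=> m n y z yz [a [h|[G SG h]]].
      by have [b zb] := K0 _ _ _ _ yz (ex_intro _ a h); exists b; left.
    have [_ KG] := svalP G.
    by have [b zb] := KG _ _ _ _ yz (ex_intro _ a h); exists b; right; exists G.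
  exists (exist P _ tP) => G SG; apply/asboolP => n y a h.
  by right; exists G.
have [|s sG] := @total_extends G; last by exists s => n y a /G0G/sG.
move=> n y; apply: contrapT => /(step _ G0G KG)[G' [GG' KG' nG']].
have tP : P G' by split=> // ? ? ? /G0G/GG'.
by have := Gmax (exist P _ tP) (introT (asboolP _) GG') => /asboolP.
Qed.

End PartialMaps.

(** * Attaching a simplex together with its cone *)

Section InnerExtension.
Variables (A : sSet) (qA : quasicategory A).
Variables (n : nat) (k : 'I_n.+1) (k_inner : 0 < k < n) (X : sSet).

Local Notation Y := (sprod (simp n) X).

Definition cone d (j : 'I_d.+1) (y : Y d) : Y d.+1 :=
  (ins k j (y.1 : mono d n), act (sigma j) y.2).

(* Domains of partial maps are kept closed under [conerel]: otherwise a maximal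
   partial map could be defined on the face of [cone j y] opposite to [j], that
   is on [y], without being defined on [cone j y] itself. *)
Inductive conerel : forall m d, Y m -> Y d -> Prop :=
  Conerel m (j : 'I_m.+1) (y : Y m) :
    first_above k (y.1 : mono m n) j -> conerel y (cone j y).

(** Deleting a vertex other than the inserted one and its successor commutes with the insertion, up
    to shifting both indices. Such a face of a cone is thus a cone over a face, which is handled by
    closure under [conerel]. *)
Lemma cone_face d (j : 'I_d.+2) (t : mono d.+1 n) (i : 'I_d.+3) :
  first_above k t j -> i <> j :> nat -> i <> j.+1 :> nat ->
  exists (j' : 'I_d.+1) (i' : 'I_d.+2),
  [/\ first_above k (mono_comp t (delta i')) j',
      mono_comp (ins k j t) (delta i) = ins k j' (mono_comp t (delta i')) &
      mono_comp (sigma j) (delta i) = mono_comp (delta i') (sigma j')].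
Proof.
move=> tj ij ij1; have jlt := ltn_ord j; have ilt := ltn_ord i.
have [i' i'E] : exists i' : 'I_d.+2, i' = unbump j i :> nat by exists (sigma j i).
have lt : unbump i' j < d.+1 by rewrite i'E /unbump; lia.
have fa : first_above k (mono_comp t (delta i')) (Ordinal lt).
  by move=> a; rewrite tj /= i'E /unbump /bump; lia.
have eqs : mono_comp (sigma j) (delta i) = mono_comp (delta i') (sigma (Ordinal lt)).
  by apply: mono_ext => a; apply: val_inj => /=; rewrite i'E /unbump /bump; lia.
exists (Ordinal lt), i'; split=> //; apply: mono_ext => a.
have [aj|aj] := eqVneq (a : nat) (unbump i' j).
  rewrite [RHS]ins_eq // [LHS](@ins_eq n k _ j t (delta i a)) //.
  by rewrite /= aj i'E /unbump /bump /=; lia.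
rewrite [RHS]ins_neq //; last exact/eqP.
rewrite [LHS](@ins_neq n k _ j t (delta i a)) //; last first.
  by move/eqP: aj; rewrite /= i'E /unbump /bump /=; lia.
by congr (t _); exact: (congr1 (fun s : mono _ _ => s a) eqs).
Qed.

(** The hypothesis on [r] says that [x] is degenerate along the edge from [j.-1] to [j]. As [t]
    takes the value [k] at [j.-1], that vertex is the one inserted by the cone over the opposite
    face [z]. *)
Lemma cone_degen d (j : 'I_d.+1) (t : mono d n) (x : X d) (r : mono d d) :
  first_above k t j -> 0 < j -> (forall a : 'I_d.+1, a = j.-1 :> nat -> t a = k) ->
  (forall a : 'I_d.+1, r a = (if a == j then j.-1 else a) :> nat) -> act r x = x ->
  exists (e : nat) (z : Y e), e < d /\ conerel z ((t, x) : Y d).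
Proof.
case: d j t x r => [|d] j t x r tj j0 tk rE xE; first by have := ltn_ord j; lia.
have lt : j.-1 < d.+1 by have := ltn_ord j; lia.
pose j1 := Ordinal lt; pose i1 : 'I_d.+2 := widen_ord (leqnSn _) j1.
pose z : Y d := (mono_comp t (delta i1), act (delta j) x).
have fa : first_above k (z.1 : mono _ _) j1.
  by move=> a; rewrite tj /= /bump; lia.
exists d, z; split=> //; rewrite (_ : (t, x) = cone j1 z); first exact: Conerel.
congr (_, _); last first.
  rewrite -act_comp -[LHS]xE; congr act; apply: mono_ext => a; apply: val_inj.
  rewrite /= rE -val_eqE /= /bump /unbump; have := ltn_ord a; case: eqP; lia.
apply: mono_ext => a; have [aj|/eqP aj] := eqVneq (a : nat) j1.
  by rewrite [RHS](ins_eq fa) // tk.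
rewrite [RHS](ins_neq fa) //=; congr (t _); apply: val_inj => /=.
by move: aj; rewrite /bump /unbump /=; lia.
Qed.

(* [(t, x)] is chosen outside the domain of [G] with [d] minimal, then [j]
   maximal.  All faces of [cone j (t, x)] but the [j]-th, which is [(t, x)], are
   then in the domain, so that an inner horn of [A] remains to be filled. *)
Section Step.
Variable G : pmap Y A.
Hypothesis Ghorn : forall m (t : simp n m) (x : X m), in_horn k t -> pdom G (t, x).
Hypothesis Gcone : kclosed conerel G.
Let D := @pdom Y A G.

Variables (d : nat) (t : simp n d) (x : X d) (j : 'I_d.+1).
Hypothesis tj : first_above k t j.
Hypothesis ntx : ~ D (t, x).
Hypothesis dmin : forall e (y : Y e), e < d -> D y.
Hypothesis jmax : forall t' (x' : X d) j', first_above k t' j' -> j < j' -> D (t', x').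

Let S : Y d.+1 := cone j (t, x).
Let jj : 'I_d.+2 := widen_ord (leqnSn _) j.

Let D_act m e (s : mono m e) (y : Y e) : D y -> D (act s y).
Proof. exact: pdom_act. Qed.

Let DS_base : act (delta jj) S = (t, x).
Proof.
congr (_, _); last by rewrite -act_comp sigma_delta ?act_id //; left.
apply: mono_ext => i; rewrite -[LHS]/(ins k j t (delta jj i)) ins_neq //; last first.
  by rewrite /= /bump; lia.
have /(congr1 (fun s : mono d d => s i)) /= -> // :=
  sigma_delta (or_introl (erefl : jj = j :> nat)).
Qed.

(** Deleting the successor of the inserted vertex moves the first vertex above [k] one step to the
    right: this case is covered by maximality of [j] or, when no vertex above [k] is left, by the
    horn, as n is missed. The other faces are cones over faces of [(t, x)], covered by minimality of
    [d]. *)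
Let DS_face (i : 'I_d.+2) : i != jj -> D (act (delta i) S).
Proof.
move=> /ord_neq ij0; have ij : i <> j :> nat := ij0.
have [ij1|ij1] := eqVneq (i : nat) j.+1.
  have -> : @act Y _ _ (delta i) S = (mono_comp (ins k j t) (delta i), x).
    by congr (_, _); rewrite -act_comp sigma_delta ?act_id //; right.
  set t' := mono_comp _ _.
  have t'j a : (t' a <= k) = (a < j.+1).
    have [aj|aj] := eqVneq (a : nat) j.
      by rewrite [t' a](ins_eq tj) ?leqnn ?aj ?ltnSn //= /bump; lia.
    rewrite [t' a](ins_neq tj); last by move/eqP: aj; rewrite /= /bump; lia.
    by rewrite tj /= /bump /unbump; move/eqP: aj; lia.
  have [jd|jd] := ltnP j.+1 d.+1.
    by apply: (@jmax _ _ (Ordinal jd)) => //=.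
  apply: Ghorn; exists ord_max; split.
    by apply/eqP => e; move: k_inner; rewrite -e /=; lia.
  move=> a; apply/eqP => e.
  have := t'j a; rewrite e /= (leq_trans (ltn_ord a) jd) => kn.
  by move: k_inner; lia.
have [e de] : exists e, d = e.+1.
  exists d.-1; move/eqP: ij1; have := ltn_ord i; have := ltn_ord j; lia.
have cf : forall d' (y : Y d') (j : 'I_d'.+1) (i : 'I_d'.+2), d' = e.+1 ->
    (forall (z : Y e), D z) -> first_above k (y.1 : mono _ _) j ->
    i <> j :> nat -> i <> j.+1 :> nat -> D (act (delta i) (cone j y)).
  move=> d' y j0 i0 d'e; case: _ / (esym d'e) y j0 i0 => -[t0 x0] j0 i0 De fa n1 n2.
  have [j' [i' [fa' e1 e2]]] := cone_face fa n1 n2.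
  have -> : @act Y _ _ (delta i0) (cone j0 (t0, x0)) =
      cone j' (@act Y _ _ (delta i') (t0, x0)).
    by congr (_, _) => //=; rewrite -!act_comp e2.
  exact: Gcone (@Conerel e j' (@act Y _ _ (delta i') (t0, x0)) fa') (De _).
apply: (cf d (t, x) j i de _ tj ij); last exact/eqP.
by move=> z; apply: dmin; rewrite de.
Qed.

Let DS_horn r (u : simp d.+1 r) : in_horn jj u -> D (act (u : mono _ _) S).
Proof.
move=> /in_horn_delta[i [s [ij ->]]]; rewrite act_comp.
by apply: D_act; apply: DS_face.
Qed.

Let delta_inj i : injective (@delta d i).
Proof. exact: lift_inj. Qed.

Let cover r (u : simp d.+1 r) : ~ in_horn jj u ->
  forall i, exists a, (u : mono _ _) a = delta jj i.
Proof. by move=> /not_in_horn h i; apply: h; rewrite eq_sym neq_lift. Qed.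

(** A simplex outside the horn hits every vertex except possibly [jj], so it has the undefined
    [(t, x)] as a face. *)
Let DS_nhorn r (u : simp d.+1 r) : ~ in_horn jj u -> ~ D (act (u : mono _ _) S).
Proof.
move=> /cover uc; have [a ua] := uc ord0.
have [s [us _]] := mono_section (@delta_inj jj) uc ua.
by move/(D_act s); rewrite -act_comp us DS_base.
Qed.

Let nhornS : ~ D S.
Proof. by move/(D_act (delta jj)); rewrite DS_base. Qed.

Let T : mono d.+1 n := ins k j t.

Let T_le b : (T b <= k) = (b <= j).
Proof.
have [bj|/eqP bj] := eqVneq (b : nat) j; first by rewrite [T b](ins_eq tj) // bj !leqnn.
by rewrite [T b](ins_neq tj) // tj /= /unbump; lia.
Qed.

Let Tj : T jj = k.
Proof. exact: (ins_eq tj). Qed.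

(** Such a [q] would fix every vertex but [jj] and send [jj] to its predecessor. Then [cone_degen]
    presents [(t, x)] as a cone over a simplex of smaller dimension, so it would lie in the
    domain. *)
Let nondegenerate (q : mono d.+1 d.+1) :
  ~ in_horn jj q -> (forall a, q a != jj) -> S <> act q S.
Proof.
move=> nq qj SE.
have qd : mono_comp q (delta jj) = delta jj.
  apply: mono_cover (@delta_inj jj) (cover _) => /DS_horn.
  by rewrite act_comp -SE DS_base.
have qid (a : 'I_d.+2) : a != jj -> q a = a.
  rewrite eq_sym => /unlift_some[b -> _].
  exact: (congr1 (fun s : mono _ _ => s b) qd).
have TqE b : T b = T (q b) by have := congr1 (fun y : Y d.+1 => (y.1 : mono _ _) b) SE.
have qjlt : q jj < j.
  have : T (q jj) <= k by rewrite -TqE Tj.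
  by rewrite T_le; have := ord_neq (qj jj); rewrite /=; lia.
have lt1 : j.-1 < d.+2 by have := ltn_ord j; lia.
have q1 : q (Ordinal lt1) = Ordinal lt1.
  by apply: qid; apply/eqP => /(congr1 val) /=; lia.
have qjj : q jj = Ordinal lt1.
  apply: val_inj => /=; have : Ordinal lt1 <= jj by rewrite /=; lia.
  by move/(monoP q); rewrite q1 /=; lia.
(* [x] is the face of [S.2] opposite [lift ord0 j], so the equation for [S] restricts to one for
   [x]. *)
pose r := mono_comp (sigma j) (mono_comp q (delta (lift ord0 j))).
have xE : act r x = x.
  have := congr1 (fun y : Y d.+1 => act (delta (lift ord0 j)) y.2) SE.
  rewrite /= -!act_comp => <-.
  by rewrite sigma_delta ?act_id //; right.
have tk (a : 'I_d.+1) : a = j.-1 :> nat -> t a = k.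
  move=> aj; rewrite -Tj TqE qjj [RHS](ins_neq tj) /=; last by lia.
  by congr (t _); apply: val_inj; rewrite /= /unbump aj; lia.
have rE (a : 'I_d.+1) : r a = (if a == j then j.-1 else a) :> nat.
  rewrite /r /=; have [->|/ord_neq aj] := eqVneq a j.
    have -> : lift (lift ord0 j : 'I_d.+2) (j : 'I_d.+2.-1) = jj.
      by apply: val_inj; rewrite /= /bump /= /bump; lia.
    by rewrite qjj /= /unbump; lia.
  rewrite qid /=; first by rewrite /bump /unbump /=; lia.
  by apply/eqP => /(congr1 val); rewrite /= /bump /= /bump; lia.
have [|e [z [ed /Gcone]]] := cone_degen tj _ tk rE xE; first by lia.
by move/(_ (dmin _ ed)); apply: ntx.
Qed.

(** A section of [u] through a chosen point turns the equation into [S = act q S] for an endomap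
    [q]; [nondegenerate] makes [q] surjective, hence the identity. *)
Let free_surj r (u u' : simp d.+1 r) : ~ in_horn jj u -> ~ in_horn jj u' ->
  act (u : mono _ _) S = act (u' : mono _ _) S ->
  (exists a, (u : mono _ _) a = jj) -> u = u'.
Proof.
move=> nu nu' uS uj; apply: mono_ext => a.
have [|||s [us sa]] := @mono_section d.+1 r d.+1 u (mono_id _) ((u : mono _ _) a) a.
- by [].
- move=> i; have [->//|] := eqVneq i jj; exact: not_in_horn nu i.
- by [].
pose q := mono_comp (u' : mono _ _) s.
have SE : S = act q S by rewrite act_comp -uS -act_comp us act_id.
have nq : ~ in_horn jj (q : simp _ _) by move/DS_horn; rewrite -SE.
have q1 : q = mono_id _.
  apply: mono_cover => // i; have [->|] := eqVneq i jj; last exact: not_in_horn nq i.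
  apply: contrapT => no; apply: nondegenerate nq _ SE => b.
  by apply/eqP => e; apply: no; exists b.
by rewrite -[in RHS]sa; have := congr1 (fun s : mono _ _ => s ((u : mono _ _) a)) q1.
Qed.

(** This injectivity makes the extension in [cone_step] single-valued. When [u] misses [jj],
    sections over [delta jj] replace sections over the identity. *)
Let free r (u u' : simp d.+1 r) : ~ in_horn jj u -> ~ in_horn jj u' ->
  act (u : mono _ _) S = act (u' : mono _ _) S -> u = u'.
Proof.
move=> nu nu' uS.
have [uj|uj] := pselect (exists a, (u : mono _ _) a = jj).
  exact: free_surj uS uj.
apply: mono_ext => a.
have /unlift_some[i ia _] : jj != (u : mono _ _) a.
  by apply/eqP => e; apply: uj; exists a.
have [s [us sa]] := mono_section (@delta_inj jj) (cover nu) ia.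
pose q := mono_comp (u' : mono _ _) s.
have qd : q = delta jj.
  apply: mono_cover (@delta_inj jj) (cover _) => /DS_horn.
  by rewrite act_comp -uS -act_comp us DS_base.
by rewrite -[in RHS]sa ia; have := congr1 (fun s : mono _ _ => s i) qd.
Qed.

Let horn_map_nat m r (v : mono m r) (u : horn jj r) :
  sval (boolp.cid (DS_horn (svalP (act v u)))) =
  act v (sval (boolp.cid (DS_horn (svalP u)))).
Proof.
apply: graph_fun (svalP (boolp.cid (DS_horn (svalP (act v u))))) _.
rewrite [act (sval _) _]act_comp.
exact: graph_act (svalP (boolp.cid (DS_horn (svalP u)))).
Qed.

Let horn_map : smap (horn jj) A := SMap horn_map_nat.

(** The newly attached simplices must again be closed under [conerel]. Since [T] takes the value [k]
    at [jj] and exceeds [k] exactly after [jj], inserting [k] into [T u] amounts to inserting the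
    vertex [jj] into [u]. *)
Let ins_simp r (j' : 'I_r.+1) (u : simp d.+1 r) : ~ in_horn jj u ->
  first_above k (mono_comp T u) j' ->
  ~ in_horn jj (ins jj j' (u : mono _ _) : simp _ _) /\
  cone j' (act (u : mono _ _) S) = act (ins jj j' (u : mono _ _)) S.
Proof.
move=> nu fa; set u' := ins jj j' _.
have fu : first_above jj (u : mono _ _) j' by move=> i; rewrite -fa T_le.
have dj a : delta (widen_ord (leqnSn _) j') a <> j' :> nat by rewrite /= /bump; lia.
have ud a : u' (delta (widen_ord (leqnSn _) j') a) = (u : mono _ _) a.
  rewrite [LHS](ins_neq fu) //; congr ((u : mono _ _) _).
  by apply: val_inj; rewrite /= /unbump /bump; lia.
split=> [[i [ij ui]]|].
  have [a ua] := not_in_horn nu ij.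
  by have := ui (delta (widen_ord (leqnSn _) j') a); rewrite ud ua eqxx.
(* Outside the horn [u] hits the successor of [jj], so its first value above [jj] is that successor,
   which [sigma j] sends to [j]. *)
have uj' : sigma j ((u : mono _ _) j') = j.
  have nej : lift ord0 j != jj by apply/eqP => /(congr1 val); rewrite /= /bump; lia.
  have [a ua] := not_in_horn nu nej.
  have j'a : j' <= a by rewrite leqNgt -fu ua /= /bump; lia.
  have := monoP (u : mono _ _) j'a; rewrite ua => le.
  have := first_above_ge fu; rewrite /= => ge.
  by apply: val_inj => /=; move: le; rewrite /= /bump /unbump; lia.
congr (_, _).
  apply: mono_ext => a; have [aj|/eqP aj] := eqVneq (a : nat) j'.
    rewrite [LHS](ins_eq fa) // -[LHS]Tj; congr (T _).
    by rewrite [RHS](ins_eq fu).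
  by rewrite [LHS](ins_neq fa) //; congr (T _); rewrite [RHS](ins_neq fu).
rewrite /= -!act_comp; congr act; apply: mono_ext => a.
have [aj|/eqP aj] := eqVneq (a : nat) j'.
  have sa : sigma j' a = j' by apply: val_inj; rewrite /= /unbump; lia.
  rewrite -[RHS]/(sigma j (u' a)) [u' a](ins_eq fu) //.
  rewrite -[LHS]/(sigma j ((u : mono _ _) (sigma j' a))) sa uj'.
  by apply: val_inj; rewrite /= /unbump; lia.
by rewrite -[RHS]/(sigma j (u' a)) [u' a](ins_neq fu).
Qed.

Lemma cone_step : exists G', [/\ pincl G G', kclosed conerel G' & ~ pincl G' G].
Proof.
(* The horn is inner at 0 because [t], being outside the horn, takes the value 0, and it does so
   before position [j]. *)
have jin : 0 < jj < d.+1.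
  have [i ti] : exists i, t i = ord0.
    apply: contrapT => no; apply: ntx; apply: Ghorn; exists ord0; split.
      by apply/eqP => e; move: k_inner; rewrite -e.
    by move=> a; apply/eqP => e; apply: no; exists a.
  have := tj i; rewrite ti /= => /esym; have := ltn_ord j; lia.
have [s sh] := qA jin horn_map.
have sG r (u : simp d.+1 r) : in_horn jj u -> G r (act (u : mono _ _) S) (s r u).
  move=> h; have := congr1 (fun f : smap (horn jj) A => f r (exist _ u h)) sh.
  by move=> /= ->; case: (boolp.cid _).
pose gr r (y : Y r) a := G r y a \/
  exists u : simp d.+1 r, [/\ ~ in_horn jj u, y = act (u : mono _ _) S & a = s r u].
have gract m r (v : mono m r) (y : Y r) a : gr _ y a -> gr _ (act v y) (act v a).
  move=> [h|[u [nu -> ->]]]; first by left; apply: graph_act.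
  have [h|h] := pselect (in_horn jj (act v u)); [left|right].
    by rewrite -smap_nat -act_comp; apply: sG.
  by exists (act v u); split=> //; rewrite -?smap_nat // -act_comp.
have grfun r (y : Y r) a b : gr _ y a -> gr _ y b -> a = b.
  move=> [h|[u [nu -> ->]]] [h'|[u' [nu' e' ->]]].
  - exact: graph_fun h h'.
  - by case: (DS_nhorn nu'); rewrite -e'; exists a.
  - by case: (DS_nhorn nu); exists b.
  - by rewrite (free nu nu' e').
exists (PMap gract grfun); split.
- by move=> r y a; left.
- move=> m r y z yz; case: _ _ _ _ / yz => m' j' y' fa [a [h|[u [nu yE _]]]].
    by have [b zb] := Gcone (Conerel fa) (ex_intro _ a h); exists b; left.
  rewrite yE in fa *; have [nu' ->] := ins_simp nu fa.
  by eexists; right; eexists; split; first exact: nu'.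
- move=> /(_ d.+1 S (s _ (mono_id _ : simp _ _))) h; apply: nhornS.
  exists (s _ (mono_id _ : simp d.+1 _)); apply: h; right.
  exists (mono_id _ : simp d.+1 _); split; rewrite ?act_id //.
  by move/DS_horn; rewrite act_id.
Qed.

End Step.

(** The simplicial subset [P] will be empty for exponentials, and consist of the two endpoints of
    Delta^1 for comma objects. *)
Theorem inner_extension (P : forall m, X m -> Prop) (G0 : pmap Y A) :
  (forall l m (v : mono l m) (x : X m), P m x -> P l (act v x)) ->
  (forall m (t : simp n m) (x : X m), pdom G0 (t, x) <-> in_horn k t \/ P m x) ->
  exists s, extends s G0.
Proof.
move=> Pact G0dom; apply: (pmap_extend (K:=conerel)).
  move=> m r y z yz; case: _ _ _ _ / yz => m' j' [t x] fa.
  move/G0dom => [[i [ik ti]]|xP]; apply/G0dom; last by right; apply: Pact.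
  left; exists i; split=> // a; rewrite /=; case: ifP => // _.
  by rewrite eq_sym.
move=> G G0G Gcone r0 y0 ny0.
have Ghorn m (t : simp n m) (x : X m) : in_horn k t -> pdom G (t, x).
  by move=> h; have [|a ta] := (G0dom m t x).2; [left|exists a; apply: G0G].
pose bad d := `[< exists y : Y d, ~ pdom G y >].
have exbad : exists d, bad d by exists r0; apply/asboolP; exists y0.
have [d /asboolP[[t x] ntx] dmin] := ex_minnP exbad.
have dmin' e (y : Y e) : e < d -> pdom G y.
  move=> ed; apply: contrapT => ny; have : bad e by apply/asboolP; exists y.
  by move/dmin; lia.
pose badj j := `[< exists (t : mono d n) (x : X d) (j' : 'I_d.+1),
  [/\ ~ pdom G ((t, x) : Y d), first_above k t j' & j' = j :> nat] >].
(* Outside the horn [t] takes the value n, which exceeds [k], so it has a first vertex above [k]. *)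
have exj : exists j, badj j.
  have [i ti] : exists i, (t : mono _ _) i = ord_max.
    apply: contrapT => no; apply: ntx; apply: Ghorn; exists ord_max; split.
      by apply/eqP => e; move: k_inner; rewrite -e /= ltnn andbF.
    by move=> a; apply/eqP => e; apply: no; exists a.
  have [|j tj] := @first_above_exists n k d t i; first by rewrite ti /=; lia.
  by exists j; apply/asboolP; exists t, x, j.
have jub j : badj j -> j <= d by move=> /asboolP[_ [_ [j' [_ _ <-]]]]; rewrite -ltnS.
have [_ /asboolP[t' [x' [j [nt tj <-]]]] jmax] := ex_maxnP exj jub.
apply: (cone_step Ghorn Gcone tj nt dmin') => t'' x'' j' fa lt.
apply: contrapT => ny; have : badj j' by apply/asboolP; exists t'', x'', j'.
by move/jmax; lia.
Qed.

End InnerExtension.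

(** * Exponentials and comma objects are quasi-categories *)

Definition yoneda (X : sSet) n (x : X n) : smap (simp n) X :=
  @SMap (simp n) X (fun m (t : mono m n) => act t x)
    (fun l m (s : mono l m) (t : mono m n) => act_comp t s x).

Section Curry.
Variables Z K A : sSet.

Lemma curry_simplex_nat (u : smap (sprod K Z) A) n (z : Z n) l m (t : mono l m)
  (x : sprod (simp n) K m) :
  u l ((act t x).2, act ((act t x).1 : mono _ _) z) =
  act t (u m (x.2, act (x.1 : mono _ _) z)).
Proof. by rewrite -smap_nat /= act_comp. Qed.

Lemma curry_nat (u : smap (sprod K Z) A) m n (t : mono m n) (z : Z n) :
  SMap (curry_simplex_nat u (act t z)) =
  act (s:=sexp A K) t (SMap (curry_simplex_nat u z)).
Proof. by apply: smap_ext => l [r v] /=; rewrite act_comp. Qed.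

Definition curry (u : smap (sprod K Z) A) : smap Z (sexp A K) :=
  @SMap Z (sexp A K) (fun n z => SMap (curry_simplex_nat u z)) (curry_nat u).

Lemma curryK u : transpose (curry u) = u.
Proof. by apply: smap_ext => n [v z] /=; rewrite act_id. Qed.

Lemma transposeK H : curry (transpose H) = H.
Proof.
apply: smap_ext => n z; apply: smap_ext => m [r v] /=.
by rewrite smap_nat /= (_ : mono_comp r _ = r) //; apply: mono_ext.
Qed.

Lemma transpose_comp (Z' : sSet) (H : smap Z (sexp A K)) (k : smap Z' Z) :
  transpose (H ∘ k) = transpose H ∘ sprodmap (sid K) k.
Proof. exact: smap_ext. Qed.

End Curry.

Section Endpoint.
Variable Z : sSet.

Lemma endpoint_nat (i : 'I_2) m n (t : mono m n) (z : Z n) :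
  ((mono_comp (vert i) (degen m), act t z) : sprod (simp 1) Z m) =
  act t ((mono_comp (vert i) (degen n), z) : sprod (simp 1) Z n).
Proof. by congr (_, _). Qed.

Definition endpoint (i : 'I_2) : smap Z (sprod (simp 1) Z) :=
  @SMap Z (sprod (simp 1) Z) (fun n z => (mono_comp (vert i) (degen n), z))
    (@endpoint_nat i).

Lemma transpose_endpoint (A : sSet) (H : smap Z (sexp A (simp 1))) i :
  transpose H ∘ endpoint i = ev A i ∘ H.
Proof. exact: smap_ext. Qed.

End Endpoint.

Section CommaMap.
Variables (A B C : sSet) (f : smap B A) (g : smap C A).

Lemma comma_ext (Z : sSet) (a a' : smap Z (comma f g)) :
  transpose (comma_arr f g ∘ a) = transpose (comma_arr f g ∘ a') ->
  comma0 f g ∘ a = comma0 f g ∘ a' -> comma1 f g ∘ a = comma1 f g ∘ a' ->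
  a = a'.
Proof.
move=> /(congr1 (@curry _ _ _)); rewrite !transposeK => e e0 e1.
apply: smap_ext => n z; apply: sval_inj.
have /= := congr1 (fun h : smap Z _ => h n z) e.
have /= := congr1 (fun h : smap Z _ => h n z) e0.
have /= := congr1 (fun h : smap Z _ => h n z) e1.
by case: (sval (a n z)) => u [c b]; case: (sval (a' n z)) => u' [c' b'] /= -> -> ->.
Qed.

Section Make.
Variables (Z : sSet) (u : smap (sprod (simp 1) Z) A) (b : smap Z B) (c : smap Z C).
Hypotheses (u0 : u ∘ endpoint Z ord0 = f ∘ b) (u1 : u ∘ endpoint Z ord_max = g ∘ c).

Let in_comma n (z : Z n) : in_spull (spair (cod A) (dom A)) (sprodmap g f)
  ((curry u n z, (c n z, b n z)) : sprod (sexp A (simp 1)) (sprod C B) n).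
Proof.
have e0 := congr1 (fun h : smap Z A => h n z) u0.
have e1 := congr1 (fun h : smap Z A => h n z) u1.
by rewrite /in_spull /= in e0 e1 *; rewrite !act_id e0 e1.
Qed.

Let comma_mk_nat m n (t : mono m n) (z : Z n) :
  exist (@in_spull _ _ _ (spair (cod A) (dom A)) (sprodmap g f) m) _
    (in_comma (act t z)) =
  act (s:=comma f g) t (exist (@in_spull _ _ _ (spair (cod A) (dom A))
    (sprodmap g f) n) _ (in_comma z)).
Proof. by apply: sval_inj; congr (_, (_, _)); apply: smap_nat. Qed.

Definition comma_mk : smap Z (comma f g) :=
  @SMap Z (comma f g) (fun n z => exist _ _ (in_comma z)) comma_mk_nat.

Lemma comma_mk_arr : transpose (comma_arr f g ∘ comma_mk) = u.
Proof. by rewrite (_ : _ ∘ comma_mk = curry u) ?curryK //; apply: smap_ext. Qed.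

Lemma comma_mk0 : comma0 f g ∘ comma_mk = b.
Proof. exact: smap_ext. Qed.

Lemma comma_mk1 : comma1 f g ∘ comma_mk = c.
Proof. exact: smap_ext. Qed.

End Make.

Lemma comma_src (Z : sSet) (a : smap Z (comma f g)) :
  transpose (comma_arr f g ∘ a) ∘ endpoint Z ord0 = f ∘ (comma0 f g ∘ a).
Proof. by rewrite transpose_endpoint -[LHS]scompA -[RHS]scompA -comma_dom. Qed.

Lemma comma_tgt (Z : sSet) (a : smap Z (comma f g)) :
  transpose (comma_arr f g ∘ a) ∘ endpoint Z ord_max = g ∘ (comma1 f g ∘ a).
Proof. by rewrite transpose_endpoint -[LHS]scompA -[RHS]scompA -comma_cod. Qed.

End CommaMap.

Lemma sexp_quasicategory (A X : sSet) : quasicategory A -> quasicategory (sexp A X).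
Proof.
move=> qA n k kn h.
(* The transpose of [h], as a partial map with domain Lambda^n_k x X. *)
pose gr m (y : sprod (simp n) X m) a :=
  exists hy : in_horn k y.1, a = (h m (exist _ y.1 hy) : smap _ _) m (mono_id m, y.2).
have hE l m (v : mono l m) (t : simp n m) (ht : in_horn k t) (hv : in_horn k (act v t)) x :
    (h l (exist _ (act v t) hv) : smap _ _) l (mono_id l, x) =
    (h m (exist _ t ht) : smap _ _) l (v, x).
  rewrite (_ : exist _ _ hv = act (s:=horn k) v (exist _ t ht)); last exact: sval_inj.
  by rewrite smap_nat /= (_ : mono_comp v _ = v) //; apply: mono_ext.
have gract l m (v : mono l m) y a : gr m y a -> gr l (act v y) (act v a).
  move: y => [t x] [ht ->]; exists (in_horn_act v ht).
  rewrite /= (hE _ _ _ _ ht) -smap_nat /=.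
  by rewrite (_ : mono_comp (mono_id m) v = v) //; apply: mono_ext.
have grfun m y a b : gr m y a -> gr m y b -> a = b.
  by move=> [hy ->] [hy' ->]; rewrite (Prop_irrelevance hy hy').
have [||s sP] := @inner_extension A qA n k kn X (fun _ _ => False) (PMap gract grfun).
- by [].
- move=> m t x; split=> [[a [ht _]]|[ht|//]]; first by left.
  by eexists; exists ht.
exists (yoneda (s : sexp A X n)); apply: smap_ext => m [t ht].
apply: smap_ext => l [r x]; rewrite [LHS]/=.
apply: sP; exists (in_horn_act (r : mono _ _) ht) => /=.
by rewrite (hE _ _ _ _ ht).
Qed.

Section CommaQuasicategory.
Variables (A B C : sSet) (f : smap B A) (g : smap C A).
Hypotheses (qA : quasicategory A) (qB : quasicategory B) (qC : quasicategory C).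

(** Fillers [b] and [c] of the projected horns prescribe the arrow of [A] over the two ends of
    Delta^1. What remains is to extend a map from the union of Lambda^n_k x Delta^1 and Delta^n x
    {0, 1} to Delta^n x Delta^1. *)
Lemma comma_quasicategory : quasicategory (comma f g).
Proof.
move=> n k kn h.
have [b bh] := qB kn (comma0 f g ∘ h); have [c ch] := qC kn (comma1 f g ∘ h).
pose H := transpose (comma_arr f g ∘ h).
pose gr m (y : sprod (simp n) (simp 1) m) a :=
  [\/ exists hy : in_horn k y.1, a = H m (y.2, exist _ y.1 hy),
      y.2 = mono_comp (vert ord0) (degen m) /\ a = f m (b m y.1) |
      y.2 = mono_comp (vert ord_max) (degen m) /\ a = g m (c m y.1)].
(* The prescriptions agree where they overlap, because [b] and [c] restrict to the projections of
   [h]. *)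
have H0 m (t : simp n m) (ht : in_horn k t) :
    H m (mono_comp (vert ord0) (degen m), exist _ t ht) = f m (b m t).
  have := congr1 (fun s : smap (horn k) A => s m (exist _ t ht)) (comma_src h).
  by rewrite -bh /= => <-.
have H1 m (t : simp n m) (ht : in_horn k t) :
    H m (mono_comp (vert ord_max) (degen m), exist _ t ht) = g m (c m t).
  have := congr1 (fun s : smap (horn k) A => s m (exist _ t ht)) (comma_tgt h).
  by rewrite -ch /= => <-.
have n01 m : mono_comp (@vert 1 ord0) (degen m) <> mono_comp (vert ord_max) (degen m).
  by move/(congr1 (fun s : mono _ _ => val (s ord0))).
have gract l m (v : mono l m) y a : gr m y a -> gr l (act v y) (act v a).
  move: y => [t x]; case=> [[ht ->]|[/= -> ->]|[/= -> ->]].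
  - constructor 1; exists (in_horn_act v ht); rewrite -(smap_nat H).
    by apply: (congr1 (fun z => H l (act v x, z))); apply: sval_inj.
  - by constructor 2; rewrite -!smap_nat.
  - by constructor 3; rewrite -!smap_nat.
have grfun m y a a' : gr m y a -> gr m y a' -> a = a'.
  move: y => [t x].
  case=> [[ht ->]|[/= e ->]|[/= e ->]]; case=> [[ht' ->]|[/= e' ->]|[/= e' ->]] //.
  - by rewrite (Prop_irrelevance ht ht').
  - by rewrite e' -(H0 _ _ ht).
  - by rewrite e' -(H1 _ _ ht).
  - by rewrite e -(H0 _ _ ht').
  - by case: (n01 m); rewrite -e -e'.
  - by rewrite e -(H1 _ _ ht').
  - by case: (n01 m); rewrite -e -e'.
pose P m (x : simp 1 m) :=
  x = mono_comp (vert ord0) (degen m) \/ x = mono_comp (vert ord_max) (degen m).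
have [||s sP] := @inner_extension A qA n k kn (simp 1) P (PMap gract grfun).
- by move=> l m v x [] ->; [left|right].
- move=> m t x; split=> [[a []]|].
  + by case=> ht _; left.
  + by case=> e _; right; left.
  + by case=> e _; right; right.
  + by case=> [ht|[e|e]]; eexists;
      [constructor 1; exists ht|constructor 2|constructor 3].
have swapn l m (v : mono l m) (y : sprod (simp 1) (simp n) m) :
    s l ((act v y).2, (act v y).1) = act v (s m (y.2, y.1)).
  by rewrite -smap_nat.
have u0 : SMap swapn ∘ endpoint (simp n) ord0 = f ∘ b.
  by apply: smap_ext => m t; apply: sP; constructor 2.
have u1 : SMap swapn ∘ endpoint (simp n) ord_max = g ∘ c.
  by apply: smap_ext => m t; apply: sP; constructor 3.
exists (comma_mk u0 u1); apply: comma_ext.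
- rewrite -scompA transpose_comp comma_mk_arr.
  by apply: smap_ext => m [v [t ht]]; apply: sP; constructor 1; exists ht.
- by rewrite -scompA comma_mk0.
- by rewrite -scompA comma_mk1.
Qed.

End CommaQuasicategory.

(** * The homotopy category of a quasi-category *)

Section HornFilling.
Variables (Q : sSet) (qQ : quasicategory Q).

(** Every simplex of the horn factors through some face; compatibility makes its value independent
    of the factorisation. *)
Lemma horn_fill k (i : 'I_k.+2) (x : 'I_k.+2 -> Q k) : 0 < i < k.+1 ->
  (forall (j j' : 'I_k.+2) r (s s' : mono r k), j != i -> j' != i ->
     mono_comp (delta j) s = mono_comp (delta j') s' ->
     act s (x j) = act s' (x j')) ->
  exists z : Q k.+1, forall j, j != i -> act (delta j) z = x j.
Proof.
move=> ik compat.
pose face r (u : horn i r) (q : Q r) := exists (j : 'I_k.+2) (s : mono r k),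
  [/\ j != i, sval u = mono_comp (delta j) s & q = act s (x j)].
have face_uniq r (u : horn i r) q q' : face r u q -> face r u q' -> q = q'.
  move=> [j [s [ji us ->]]] [j' [s' [ji' us' ->]]].
  by apply: compat => //; rewrite -us -us'.
have /(_ _ _)/boolp.cid ex r (u : horn i r) : exists q, face r u q.
  by have [j [s [ji us]]] := in_horn_delta (svalP u); exists (act s (x j)), j, s.
have xnat m n (t : mono m n) (u : horn i n) :
    sval (ex m (act t u)) = act t (sval (ex n u)).
  apply: face_uniq (svalP (ex m (act t u))) _.
  have [j [s [ji us ->]]] := svalP (ex n u).
  by exists j, (mono_comp s t); rewrite act_comp; split=> //=; rewrite us.
have [h hP] := qQ ik (SMap xnat).
exists (h _ (mono_id _ : simp k.+1 _)) => j ji.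
rewrite -smap_nat (_ : act _ _ = (delta j : simp k.+1 k)); last exact: mono_ext.
have jh : in_horn i (delta j : simp k.+1 k).
  by exists j; split=> // a; rewrite eq_sym neq_lift.
have := congr1 (fun f : smap (horn i) Q => f _ (exist _ (delta j : simp k.+1 k) jh)) hP.
move=> /= ->; apply: face_uniq (svalP (ex _ _)) _.
by exists j, (mono_id k); rewrite act_id; split=> //; apply: mono_ext.
Qed.

(** The cosimplicial identity for two distinct cofaces is a pullback square; this is the existence
    of the factorisation. *)
Lemma delta_square k (j j' : 'I_k.+3) r (s s' : mono r k.+1) (l l' : 'I_k.+2) :
  j < j' -> l' = j'.-1 :> nat -> l = j :> nat ->
  mono_comp (delta j) s = mono_comp (delta j') s' ->
  exists s'' : mono r k, s = mono_comp (delta l') s'' /\ s' = mono_comp (delta l) s''.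
Proof.
move=> jj l'E lE e.
have ea a : bump j (s a) = bump j' (s' a).
  by have := congr1 (fun f : mono _ _ => val (f a)) e.
have sne a : s a <> l' :> nat by have := ea a; rewrite l'E /bump; lia.
have lt a : unbump l' (s a) < k.+1.
  have := sne a; have := ltn_ord (s a); have := ltn_ord l'; rewrite /unbump; lia.
have sm (a b : 'I_r.+1) : a <= b -> Ordinal (lt a) <= Ordinal (lt b).
  by move/(monoP s) => /=; rewrite /unbump; lia.
exists (Mono sm); split; apply: mono_ext => a; apply: val_inj => /=.
  by have := sne a; rewrite /bump /unbump; lia.
by have := sne a; have := ea a; rewrite lE l'E /bump /unbump; lia.
Qed.

(** By [delta_square], compatibility need only be tested on the common faces of codimension two. *)
Lemma horn_fill_faces k (i : 'I_k.+3) (x : 'I_k.+3 -> Q k.+1) : 0 < i < k.+2 ->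
  (forall (j j' : 'I_k.+3) (l l' : 'I_k.+2), j < j' -> j != i -> j' != i ->
     l' = j'.-1 :> nat -> l = j :> nat ->
     act (delta l') (x j) = act (delta l) (x j')) ->
  exists z : Q k.+2, forall j, j != i -> act (delta j) z = x j.
Proof.
move=> ik faces; apply: horn_fill => //.
have half (j j' : 'I_k.+3) r (s s' : mono r k.+1) : j < j' -> j != i -> j' != i ->
     mono_comp (delta j) s = mono_comp (delta j') s' -> act s (x j) = act s' (x j').
  move=> jj ji ji' e; have lt' : j'.-1 < k.+2 by have := ltn_ord j'; lia.
  have lt : j < k.+2 by have := ltn_ord j'; lia.
  have [s'' [-> ->]] := @delta_square _ _ _ _ _ _ (Ordinal lt) (Ordinal lt') jj erefl erefl e.
  by rewrite !act_comp; congr act; apply: faces.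
move=> j j' r s s' ji ji' e; have [lt|lt|/val_inj jj] := ltngtP j j'.
- exact: half e.
- exact/esym/half/esym.
- rewrite jj in e *; congr act; apply: mono_ext => a; apply: (@lift_inj _ j').
  by have := congr1 (fun f : mono _ _ => f a) e.
Qed.

End HornFilling.

(** * Triangles, homotopies of edges and values of paths *)

Section Triangles.
Variable Q : sSet.

Local Notation o2 i := (@Ordinal 2 i isT).
Local Notation o3 i := (@Ordinal 3 i isT).
Local Notation o4 i := (@Ordinal 4 i isT).

Lemma face_delta (l : 'I_3) : delta l =
  (if l == 0 :> nat then face12 else if l == 1 :> nat then face02 else face01).
Proof.
by case: l => [[|[|[|//]]] ?]; apply: mono_ext => -[[|[|//]] ?]; apply: val_inj.
Qed.

Lemma vert0E : @vert 1 ord0 = delta (o2 1).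
Proof. by apply: mono_ext => -[[|//] ?]; apply: val_inj. Qed.

Lemma vert1E : @vert 1 ord_max = delta (o2 0).
Proof. by apply: mono_ext => -[[|//] ?]; apply: val_inj. Qed.

Definition boundary2 (s : Q 2) (a b c : Q 1) : Prop :=
  [/\ act face01 s = a, act face12 s = b & act face02 s = c].

Definition tri (a b c : Q 1) : Prop := exists s, boundary2 s a b c.

Definition deg1 (x : Q 0) : Q 1 := act (degen 1) x.

Lemma boundary2_ends (s : Q 2) a b c : boundary2 s a b c ->
  [/\ tgt a = src b, src c = src a & tgt c = tgt b].
Proof.
by move=> [<- <- <-]; rewrite /src /tgt -!act_comp; split; congr act; apply: mono_ext.
Qed.

Lemma tri_ends a b c : tri a b c -> [/\ tgt a = src b, src c = src a & tgt c = tgt b].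
Proof. by move=> [s /boundary2_ends]. Qed.

Lemma degen_end (x : Q 0) (t : mono 0 0) : act t x = x.
Proof.
by rewrite (_ : t = mono_id 0) ?act_id //; apply: mono_ext => i; rewrite !ord1.
Qed.

Lemma src_deg1 x : src (deg1 x) = x.
Proof. by rewrite /src /deg1 -act_comp degen_end. Qed.

Lemma tgt_deg1 x : tgt (deg1 x) = x.
Proof. by rewrite /tgt /deg1 -act_comp degen_end. Qed.

Lemma boundary2_degl a : boundary2 (act (sigma (o2 0)) a) (deg1 (src a)) a a.
Proof.
split; [rewrite /deg1 /src -!act_comp|rewrite -act_comp -[RHS]act_id|
  rewrite -act_comp -[RHS]act_id]; apply: (congr1 (fun t => act t a));
  by apply: mono_ext => -[[|[|//]] ?]; apply: val_inj.
Qed.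

Lemma boundary2_degr a : boundary2 (act (sigma (o2 1)) a) a (deg1 (tgt a)) a.
Proof.
split; [rewrite -act_comp -[RHS]act_id|rewrite /deg1 /tgt -!act_comp|
  rewrite -act_comp -[RHS]act_id]; apply: (congr1 (fun t => act t a));
  by apply: mono_ext => -[[|[|//]] ?]; apply: val_inj.
Qed.

Lemma tri_degl a : tri (deg1 (src a)) a a.
Proof. by eexists; apply: boundary2_degl. Qed.

Lemma tri_degr a : tri a (deg1 (tgt a)) a.
Proof. by eexists; apply: boundary2_degr. Qed.

Hypothesis qQ : quasicategory Q.

Lemma tri_exists a b : tgt a = src b -> exists c, tri a b c.
Proof.
move=> ab; pose x (j : 'I_3) := if j == 0 :> nat then b else a.
have [||s sP] := @horn_fill_faces Q qQ 0 (o3 1) x; first by [].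
  case=> [[|[|[|//]]] ?] [[|[|[|//]]] ?] l l' // _ _ _ l'E lE; rewrite /x /=.
  rewrite (_ : l' = o2 1) -?vert0E; last exact: val_inj.
  by rewrite (_ : l = o2 0) -?vert1E; last exact: val_inj.
exists (act face02 s), s; split=> //.
  by have := sP (o3 2) isT; rewrite face_delta.
by have := sP (o3 0) isT; rewrite face_delta.
Qed.

Definition boundary3 (z : Q 3) (s012 s123 s013 s023 : Q 2) : Prop :=
  [/\ act (delta (o4 3)) z = s012, act (delta (o4 0)) z = s123,
      act (delta (o4 2)) z = s013 & act (delta (o4 1)) z = s023].

Lemma boundary3_edge z s012 s123 s013 s023 : boundary3 z s012 s123 s013 s023 ->
  [/\ act face01 s023 = act face02 s012, act face12 s023 = act face12 s123 &
      act face02 s023 = act face02 s013] /\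
  [/\ act face01 s013 = act face01 s012, act face12 s013 = act face02 s123 &
      act face02 s013 = act face02 s023].
Proof.
by move=> [<- <- <- <-]; rewrite -!act_comp; split; split; congr act;
  apply: mono_ext => -[[|[|//]] ?]; apply: val_inj.
Qed.

(** The 3-simplex is returned along with its new face, as [comma_homotopy_inverse] turns it into a
    triangle over the comma object. *)
Lemma fill31 s012 s123 s013 a b c p q r : boundary2 s012 a b p ->
  boundary2 s123 b c q -> boundary2 s013 a q r ->
  exists z s023, boundary3 z s012 s123 s013 s023 /\ boundary2 s023 p c r.
Proof.
move=> [e1 e2 e3] [e4 e5 e6] [e7 e8 e9].
pose x (j : 'I_4) := if j == 0 :> nat then s123 else if j == 2 :> nat then s013 else s012.
have [||z zP] := @horn_fill_faces Q qQ 1 (o4 1) x; first by [].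
  case=> [[|[|[|[|//]]]] ?] [[|[|[|[|//]]]] ?] [[|[|[|//]]] ?] [[|[|[|//]]] ?] //
    _ _ _ _ _; rewrite /x /=.
  - by rewrite !face_delta /= e6 e8.
  - by rewrite !face_delta /= e4 e2.
  - by rewrite !face_delta /= e7 e1.
have b3 : boundary3 z s012 s123 s013 (act (delta (o4 1)) z).
  by split=> //; apply: zP.
exists z, (act (delta (o4 1)) z); split=> //.
by have [[f1 f2 f3] _] := boundary3_edge b3; split; rewrite ?f1 ?f2 ?f3.
Qed.

Lemma fill32 s012 s123 s023 a b c p q r : boundary2 s012 a b p ->
  boundary2 s123 b c q -> boundary2 s023 p c r ->
  exists z s013, boundary3 z s012 s123 s013 s023 /\ boundary2 s013 a q r.
Proof.
move=> [e1 e2 e3] [e4 e5 e6] [e7 e8 e9].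
pose x (j : 'I_4) := if j == 0 :> nat then s123 else if j == 1 :> nat then s023 else s012.
have [||z zP] := @horn_fill_faces Q qQ 1 (o4 2) x; first by [].
  case=> [[|[|[|[|//]]]] ?] [[|[|[|[|//]]]] ?] [[|[|[|//]]] ?] [[|[|[|//]]] ?] //
    _ _ _ _ _; rewrite /x /=.
  - by rewrite !face_delta /= e5 e8.
  - by rewrite !face_delta /= e4 e2.
  - by rewrite !face_delta /= e7 e3.
have b3 : boundary3 z s012 s123 (act (delta (o4 2)) z) s023.
  by split=> //; apply: zP.
exists z, (act (delta (o4 2)) z); split=> //.
by have [_ [f1 f2 f3]] := boundary3_edge b3; split; rewrite ?f1 ?f2 ?f3.
Qed.

(** This and [tri_assocl] are the two inner horns of Delta^3. The laws of [homotopic] are their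
    instances with a degenerate edge. *)
Lemma tri_assocr a b c p q r : tri a b p -> tri b c q -> tri a q r -> tri p c r.
Proof.
move=> [s sP] [s' sP'] [s'' sP''].
by have [_ [t [_ tP]]] := fill31 sP sP' sP''; exists t.
Qed.

Lemma tri_assocl a b c p q r : tri a b p -> tri b c q -> tri p c r -> tri a q r.
Proof.
move=> [s sP] [s' sP'] [s'' sP''].
by have [_ [t [_ tP]]] := fill32 sP sP' sP''; exists t.
Qed.

Definition homotopic (a b : Q 1) : Prop := tri a (deg1 (tgt a)) b.

Lemma homotopic_refl a : homotopic a a.
Proof. exact: tri_degr. Qed.

Lemma homotopic_ends a b : homotopic a b -> src a = src b /\ tgt a = tgt b.
Proof. by move=> /tri_ends[_ -> ->]; rewrite tgt_deg1. Qed.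

Lemma tri_homotopic a b c c' : tri a b c -> tri a b c' -> homotopic c c'.
Proof.
move=> abc abc'; have [_ _ cb] := tri_ends abc.
by apply: (tri_assocr abc _ abc'); rewrite cb; apply: tri_degr.
Qed.

Lemma homotopic_sym a b : homotopic a b -> homotopic b a.
Proof. by move=> ab; apply: tri_homotopic ab (homotopic_refl a). Qed.

Lemma homotopic_trans a b c : homotopic a b -> homotopic b c -> homotopic a c.
Proof.
move=> ab bc; have [_ tab] := homotopic_ends ab.
apply: (tri_assocl ab _ bc); rewrite tab.
by have := tri_degr (deg1 (tgt b)); rewrite tgt_deg1.
Qed.

Lemma tri_eqr a b c c' : homotopic c c' -> tri a b c -> tri a b c'.
Proof.
move=> cc' abc; have [_ _ cb] := tri_ends abc.
by apply: (tri_assocl abc _ cc'); rewrite cb; apply: tri_degr.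
Qed.

Lemma tri_eqm a b b' c : homotopic b b' -> tri a b c -> tri a b' c.
Proof.
move=> bb' abc; have [_ _ cb] := tri_ends abc.
by apply: (tri_assocl abc bb'); rewrite -cb; apply: tri_degr.
Qed.

Lemma tri_eql a a' b c : homotopic a a' -> tri a b c -> tri a' b c.
Proof.
move=> aa' abc; have [ab _ _] := tri_ends abc.
by apply: (tri_assocr aa' _ abc); rewrite ab; apply: tri_degl.
Qed.

Lemma degl_homotopic (a : Q 0) b c : tri (deg1 a) b c -> homotopic b c.
Proof.
move=> abc; have [ab _ _] := tri_ends abc; rewrite tgt_deg1 in ab.
by rewrite ab in abc; apply: tri_homotopic (tri_degl b) abc.
Qed.

(* Since composites are only defined up to homotopy, the value of a path is a
   relation; it is stable under [pathrel]. *)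
Fixpoint path_value x y (p : Defs.path x y) : Q 1 -> Prop :=
  match p with
  | pnil x => homotopic (deg1 x)
  | pcons _ _ _ e p' => fun c => exists2 b, path_value p' b & tri (sval e) b c
  end.

Lemma path_value_ends x y (p : Defs.path x y) c : path_value p c -> src c = x /\ tgt c = y.
Proof.
elim: p c => /= [{}x|{}x {}y z e p IH] c.
  by move=> /homotopic_ends[<- <-]; rewrite src_deg1 tgt_deg1.
by move=> [b /IH[_ bz] /tri_ends[_ -> ->]]; case: (svalP e).
Qed.

Lemma path_value_eq x y (p : Defs.path x y) c c' :
  homotopic c c' -> path_value p c -> path_value p c'.
Proof.
case: p => /= [{}x|{}x {}y z e p] cc'; first by move/homotopic_trans; apply.
by move=> [b pb ebc]; exists b => //; apply: tri_eqr ebc.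
Qed.

Lemma path_value_exists x y (p : Defs.path x y) : exists c, path_value p c.
Proof.
elim: p => /= [{}x|{}x {}y z e p [b pb]].
  by exists (deg1 x); apply: homotopic_refl.
have [|c ebc] := @tri_exists (sval e) b; last by exists c, b.
by have [-> _] := path_value_ends pb; case: (svalP e).
Qed.

Lemma path_value_cat x y z (p : Defs.path x y) (q : Defs.path y z) c :
  path_value (pcat p q) c <->
  exists a b, [/\ path_value p a, path_value q b & tri a b c].
Proof.
elim: p q c => /= [{}x|{}x {}y w e p IH] q c; split.
- move=> qc; have [cx _] := path_value_ends qc.
  exists (deg1 x), c; split=> //; first exact: homotopic_refl.
  by rewrite -cx; apply: tri_degl.
- move=> [a [b [xa qb abc]]]; apply: path_value_eq qb.
  exact: degl_homotopic (tri_eql (homotopic_sym xa) abc).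
- move=> [d /IH[a [b [pa qb abd]]] edc].
  have [|s sa] := @tri_exists (sval e) a.
    by have [-> _] := path_value_ends pa; case: (svalP e).
  by exists s, b; split=> //; [exists a|apply: tri_assocr sa abd edc].
- move=> [s [b [[a pa eas] qb sbc]]].
  have [d abd] : exists d, tri a b d.
    apply: tri_exists; have [_ ->] := path_value_ends pa.
    by have [-> _] := path_value_ends qb.
  by exists d; [apply/IH; exists a, b|apply: tri_assocl eas abd sbc].
Qed.

Lemma edge_tgt (x y : Q 0) (e : edge x y) : tgt (sval e) = y.
Proof. by case: (svalP e). Qed.

Lemma path_value_one x y (e : edge x y) c :
  path_value (pone e) c <-> homotopic (sval e) c.
Proof.
split=> /= [[b yb ebc]|ec].
  by rewrite /homotopic edge_tgt; apply: tri_eqm (homotopic_sym yb) ebc.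
by exists (deg1 y); [apply: homotopic_refl|move: ec; rewrite /homotopic edge_tgt].
Qed.

(** This invariant of the generated congruence is what reads an equality in the homotopy category
    back as an actual homotopy, in [ho_edge_eq]. *)
Lemma path_value_rel x y (p q : Defs.path x y) :
  pathrel p q -> forall c, path_value p c <-> path_value q c.
Proof.
elim=> {x y p q}.
- by [].
- by move=> x y p q _ IH c; rewrite IH.
- by move=> x y p q r _ IH _ IH' c; rewrite IH.
- move=> x y z p p' q q' _ IH _ IH' c; rewrite !path_value_cat.
  by split=> -[a [b [/IH pa /IH' qb abc]]]; exists a, b.
- by move=> x e ex c; rewrite path_value_one ex.
- move=> x y z a b c s sa sb sc d.
  have abc : tri (sval a) (sval b) (sval c) by exists s.
  rewrite path_value_one; split=> [[u /path_value_one bu aud]|cd].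
    exact: tri_homotopic abc (tri_eqm (homotopic_sym bu) aud).
  exists (sval b); first by apply/path_value_one/homotopic_refl.
  exact: tri_eqr cd abc.
Qed.

Lemma ho_edge_tri x y z (a : edge x y) (b : edge y z) (c : edge x z) :
  tri (sval a) (sval b) (sval c) -> Defs.comp (ho_edge b) (ho_edge a) = ho_edge c.
Proof.
move=> [s [s0 s1 s2]].
by rewrite /= ho_comp_cls; apply/ho_clsP; apply: pathrel_tri s0 s1 s2.
Qed.

Lemma ho_edge_deg x (e : edge x x) : sval e = deg1 x -> ho_edge e = @idm (ho Q) x.
Proof. by move=> ex; apply/ho_clsP/pathrel_degen. Qed.

Lemma deg1_ends x : src (deg1 x) = x /\ tgt (deg1 x) = x.
Proof. by rewrite src_deg1 tgt_deg1. Qed.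

Lemma ho_edge_eq x y (e e' : edge x y) :
  ho_edge e = ho_edge e' <-> homotopic (sval e) (sval e').
Proof.
split=> [/ho_clsP/path_value_rel h|ee'].
  by apply/path_value_one; rewrite h; exact/path_value_one/homotopic_refl.
pose d : edge y y := exist _ (deg1 y) (deg1_ends y).
rewrite -(@ho_edge_tri _ _ _ e d e') ?(@ho_edge_deg _ d) ?comp1m //=.
by move: ee'; rewrite /homotopic edge_tgt.
Qed.

Lemma path_value_cls x y (p : Defs.path x y) c (cxy : src c = x /\ tgt c = y) :
  path_value p c -> ho_cls p = ho_edge (exist _ c cxy).
Proof.
elim: p c cxy => /= [{}x|{}x {}y z e p IH] c cxy.
  move=> xc; rewrite -(ho_edge_eq (exist _ (deg1 x) (deg1_ends x)) _).2 //.
  exact/esym/ho_edge_deg.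
move=> [b pb ebc]; have by_ := path_value_ends pb.
rewrite -(@ho_edge_tri _ _ _ e (exist _ b by_) (exist _ c cxy)) //.
by rewrite -IH // /= ho_comp_cls.
Qed.

Lemma ho_edge_exists (x y : Q 0) (a : @hom (ho Q) x y) : exists e, a = ho_edge e.
Proof.
have [p ->] := ho_homP a; have [c pc] := path_value_exists p.
by exists (exist _ c (path_value_ends pc)); apply: path_value_cls.
Qed.

End Triangles.

(** * Whiskering and interchange *)

Section ArrowAlgebra.
Variable C : category.

Definition asrc (t : arrow C) : C := (tag t).1.
Definition atgt (t : arrow C) : C := (tag t).2.

(* Composition of arrows with propositionally matching boundaries (and the
   junk value [a] otherwise), so that composites can be rewritten without
   casts. *)
Definition acomp (b a : arrow C) : arrow C :=
  match pselect (atgt a = asrc b) with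
  | left e => tarr (Defs.comp (tagged b) (hcast erefl e (tagged a)))
  | right _ => a
  end.

Lemma acompE (x y z : C) (b : hom y z) (a : hom x y) :
  acomp (tarr b) (tarr a) = tarr (Defs.comp b a).
Proof. by rewrite /acomp; case: pselect => // e; rewrite hcast_id. Qed.

Lemma asrc_comp b a : atgt a = asrc b -> asrc (acomp b a) = asrc a.
Proof. by move=> e; rewrite /acomp; case: pselect. Qed.

Lemma atgt_comp b a : atgt a = asrc b -> atgt (acomp b a) = atgt b.
Proof. by move=> e; rewrite /acomp; case: pselect. Qed.

Lemma acompA c b a : atgt a = asrc b -> atgt b = asrc c ->
  acomp c (acomp b a) = acomp (acomp c b) a.
Proof.
case: a b c => [[x y] a] [[y' z] b] [[z' t] c]; rewrite /atgt /asrc /= => e e'.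
case: _ / e b => b; case: _ / e' c => c.
by rewrite !acompE compmA.
Qed.

Lemma acomp1m x a : atgt a = x -> acomp (tarr (idm x)) a = a.
Proof.
case: a => [[y z] a]; rewrite /atgt /= => <-.
by rewrite (acompE (idm z) a) comp1m.
Qed.

Lemma acompm1 x a : asrc a = x -> acomp a (tarr (idm x)) = a.
Proof.
case: a => [[y z] a]; rewrite /asrc /= => <-.
by rewrite (acompE a (idm y)) compm1.
Qed.

Lemma arrowP (t : arrow C) x y : asrc t = x -> atgt t = y ->
  exists a : hom x y, t = tarr a.
Proof. by case: t => [[x' y'] a]; rewrite /asrc /atgt /= => <- <-; exists a. Qed.

End ArrowAlgebra.

Definition amap (C D : category) (F : functor C D) (t : arrow C) : arrow D :=
  tarr (fhom F (tagged t)).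

Lemma amap_comp (C D : category) (F : functor C D) (b a : arrow C) :
  atgt a = asrc b -> amap F (acomp b a) = acomp (amap F b) (amap F a).
Proof.
case: a b => [[x y] a] [[y' z] b]; rewrite /atgt /asrc /= => e.
by case: _ / e b => b; rewrite (acompE b a) /amap acompE /= fhomM.
Qed.

Lemma amap_idm (C D : category) (F : functor C D) x :
  amap F (tarr (idm x)) = tarr (idm (F x)).
Proof. by rewrite /amap /= fhom1. Qed.

Lemma ho_fun_comp (X Y Z : sSet) (F : smap Y Z) (G : smap X Y) x y (a : ho_hom x y) :
  ho_fun F (ho_fun G a) = ho_fun (F ∘ G) a.
Proof.
have {a}[p ->] := ho_homP a; rewrite !ho_fun_cls; congr ho_cls.
elim: p => //= {}x {}y z e p ->; congr pcons; exact: sval_inj.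
Qed.

Lemma ho_fun_id (X : sSet) x y (a : ho_hom x y) : ho_fun (sid X) a = a.
Proof.
have {a}[p ->] := ho_homP a; rewrite !ho_fun_cls; congr ho_cls.
elim: p => //= {}x {}y z e p ->; congr pcons; exact: sval_inj.
Qed.

Lemma amap_ho_comp (X Y Z : sSet) (F : smap Y Z) (G : smap X Y) t :
  amap (ho_map F) (amap (ho_map G) t) = amap (ho_map (F ∘ G)) t.
Proof. by case: t => [[x y] a]; rewrite /amap /= ho_fun_comp. Qed.

Lemma amap_ho_id (X : sSet) t : amap (ho_map (sid X)) t = t.
Proof. by case: t => [[x y] a]; rewrite /amap /= ho_fun_id. Qed.

Section EdgeArrow.
Variable Q : sSet.

Definition arr_edge (e : Q 1) : arrow (ho Q) :=
  tarr (ho_edge (exist (fun e => src e = _ /\ tgt e = _) e (conj erefl erefl))).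

Lemma tarr_ho_edgeE x y (e : edge x y) : tarr (ho_edge e) = arr_edge (sval e).
Proof. exact: tarr_ho_edge. Qed.

Lemma arr_edge_tri a b c : tri a b c -> acomp (arr_edge b) (arr_edge a) = arr_edge c.
Proof.
move=> abc; have [ab ca cb] := tri_ends abc.
pose b' : edge (tgt a) (tgt b) := exist _ b (conj (esym ab) erefl).
pose c' : edge (src a) (tgt b) := exist _ c (conj ca cb).
rewrite -(@tarr_ho_edgeE _ _ c') -(@tarr_ho_edgeE _ _ b') acompE.
by rewrite (ho_edge_tri (c := c')).
Qed.

Lemma arr_edge_deg x : arr_edge (deg1 x) = tarr (@idm (ho Q) x).
Proof.
pose d : edge x x := exist _ (deg1 x) (deg1_ends x).
by rewrite -(@tarr_ho_edgeE _ _ d) ho_edge_deg.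
Qed.

Hypothesis qQ : quasicategory Q.

Lemma arr_edge_exists t : exists e, t = arr_edge e.
Proof.
case: t => [[x y] a]; have [e ->] := ho_edge_exists qQ a.
by exists (sval e); apply: tarr_ho_edgeE.
Qed.

Lemma arr_edge_homotopic e e' : arr_edge e = arr_edge e' -> homotopic e e'.
Proof.
move=> ee'; have es : src e' = src e by have := congr1 (@asrc _) ee'.
have et : tgt e' = tgt e by have := congr1 (@atgt _) ee'.
move: ee'; pose d : edge (src e) (tgt e) := exist _ e' (conj es et).
rewrite -(@tarr_ho_edgeE _ _ d) => /tarr_inj /ho_edge_eq h; exact: h.
Qed.

End EdgeArrow.

Lemma amap_edge (Q R : sSet) (F : smap Q R) e :
  amap (ho_map F) (arr_edge e) = arr_edge (F 1 e).
Proof.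
rewrite /amap /= ho_fun_cls.
by rewrite -[RHS](@tarr_ho_edge _ _ _ _ _ (edge_map F (exist _ e (conj erefl erefl)))).
Qed.

Notation acell A B := (arrow (ho (sexp B A))).

Section Cells.

(** With boundaries as propositions, rebracketing composites of functors changes only [f] and [g],
    never the 2-cell. *)
Definition bnd (A B : sSet) (t : acell A B) (f g : smap A B) : Prop :=
  asrc t = vtx f /\ atgt t = vtx g.

Definition wl (A B D : sSet) (h : smap B D) : acell A B -> acell A D :=
  amap (ho_map (sexp_post A h)).

Definition wr (X A B : sSet) (k : smap X A) : acell A B -> acell X B :=
  amap (ho_map (sexp_pre B k)).

Definition aid (A B : sSet) (f : smap A B) : acell A B := tarr (Defs.cid f).

Variables X A B D : sSet.

Lemma bnd_tarr (f g : smap A B) (a : cell f g) : bnd (tarr a) f g.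
Proof. by []. Qed.

Lemma bndP (t : acell A B) f g : bnd t f g -> exists a : cell f g, t = tarr a.
Proof. by case; apply: arrowP. Qed.

Lemma bnd_wl (h : smap B D) (t : acell A B) f g :
  bnd t f g -> bnd (wl h t) (h ∘ f) (h ∘ g).
Proof.
by move=> [tf tg]; rewrite /bnd -!vtx_post -tf -tg.
Qed.

Lemma bnd_wr (k : smap X A) (t : acell A B) f g :
  bnd t f g -> bnd (wr k t) (f ∘ k) (g ∘ k).
Proof.
by move=> [tf tg]; rewrite /bnd -!vtx_pre -tf -tg.
Qed.

Lemma bnd_comp (s t : acell A B) f g h :
  bnd s f g -> bnd t g h -> bnd (acomp t s) f h.
Proof.
move=> [sf sg] [tg th]; rewrite /bnd asrc_comp ?atgt_comp ?sg ?tg //.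
Qed.

Lemma cell_compA (s t u : acell A B) f g h k : bnd s f g -> bnd t g h -> bnd u h k ->
  acomp u (acomp t s) = acomp (acomp u t) s.
Proof. by move=> [_ sg] [tg th] [uh _]; rewrite acompA ?sg ?tg ?th ?uh. Qed.

Lemma cell_comp1m (t : acell A B) f g : bnd t f g -> acomp (aid g) t = t.
Proof. by move=> [_ tg]; apply: acomp1m. Qed.

Lemma cell_compm1 (t : acell A B) f g : bnd t f g -> acomp t (aid f) = t.
Proof. by move=> [tf _]; apply: acompm1. Qed.

Lemma wl_comp (h : smap B D) (s t : acell A B) f g k : bnd s f g -> bnd t g k ->
  wl h (acomp t s) = acomp (wl h t) (wl h s).
Proof. by move=> [_ sg] [tg _]; apply: amap_comp; rewrite sg tg. Qed.

Lemma wr_comp (h : smap X A) (s t : acell A B) f g k : bnd s f g -> bnd t g k ->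
  wr h (acomp t s) = acomp (wr h t) (wr h s).
Proof. by move=> [_ sg] [tg _]; apply: amap_comp; rewrite sg tg. Qed.

Lemma wl_aid (h : smap B D) (f : smap A B) : wl h (aid f) = aid (h ∘ f).
Proof. by rewrite /wl amap_idm; apply: tarr_idm; apply: vtx_post. Qed.

Lemma wr_aid (k : smap X A) (f : smap A B) : wr k (aid f) = aid (f ∘ k).
Proof. by rewrite /wr amap_idm; apply: tarr_idm; apply: vtx_pre. Qed.

Lemma wl_edge (h : smap B D) (e : sexp B A 1) :
  wl h (arr_edge e) = arr_edge (h ∘ (e : smap _ _) : sexp D A 1).
Proof. exact: amap_edge. Qed.

Lemma wr_edge (k : smap X A) (e : sexp B A 1) :
  wr k (arr_edge e) = arr_edge ((e : smap _ _) ∘ sprodmap (sid _) k : sexp B X 1).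
Proof. exact: amap_edge. Qed.

Lemma wl_sid (t : acell A B) : wl (sid B) t = t.
Proof.
rewrite /wl (_ : sexp_post A (sid B) = sid _) ?amap_ho_id //.
by apply: smap_ext => n u; apply: smap_ext.
Qed.

Lemma wr_sid (t : acell A B) : wr (sid A) t = t.
Proof.
rewrite /wr (_ : sexp_pre B (sid A) = sid _) ?amap_ho_id //.
by apply: smap_ext => n u; apply: smap_ext => m [].
Qed.

Lemma wl_wr (h : smap B D) (k : smap X A) (t : acell A B) :
  wl h (wr k t) = wr k (wl h t).
Proof.
rewrite /wl /wr !amap_ho_comp; congr (amap (ho_map _) t).
by apply: smap_ext => n u; apply: smap_ext.
Qed.

Lemma tarr_vcomp (f g h : smap A B) (b : cell g h) (a : cell f g) :
  tarr (vcomp b a) = acomp (tarr b) (tarr a).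
Proof. by rewrite acompE. Qed.

Lemma tarr_whiskl (h : smap B D) (f g : smap A B) (a : cell f g) :
  tarr (whiskl h a) = wl h (tarr a).
Proof. by rewrite tarr_hcast. Qed.

Lemma tarr_whiskr (k : smap X A) (f g : smap A B) (a : cell f g) :
  tarr (whiskr a k) = wr k (tarr a).
Proof. by rewrite tarr_hcast. Qed.

Lemma tarr_ccast (f f' g g' : smap A B) (ef : f = f') (eg : g = g') (a : cell f g) :
  tarr (ccast ef eg a) = tarr a.
Proof. exact: tarr_hcast. Qed.

Lemma src_vtx (e : sexp B A 1) : src e = vtx ((e : smap _ _) ∘ endpoint A ord0).
Proof.
apply: smap_ext => n [t a] /=; congr ((e : smap _ _) n (_, a)); exact: mono_ext.
Qed.

Lemma tgt_vtx (e : sexp B A 1) : tgt e = vtx ((e : smap _ _) ∘ endpoint A ord_max).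
Proof.
apply: smap_ext => n [t a] /=; congr ((e : smap _ _) n (_, a)); exact: mono_ext.
Qed.

Lemma bnd_edge (e : sexp B A 1) f g : bnd (arr_edge e) f g <->
  (e : smap _ _) ∘ endpoint A ord0 = f /\ (e : smap _ _) ∘ endpoint A ord_max = g.
Proof.
rewrite /bnd -[asrc _]/(src e) -[atgt _]/(tgt e) src_vtx tgt_vtx; split=> [[]|[-> ->] //].
by move=> /(bij_inj (vtx_bij B A)) -> /(bij_inj (vtx_bij B A)) ->.
Qed.

End Cells.

Lemma wl_wl (A B D E : sSet) (h : smap B D) (k : smap D E) (t : acell A B) :
  wl k (wl h t) = wl (k ∘ h) t.
Proof.
rewrite /wl !amap_ho_comp; congr (amap (ho_map _) t).
by apply: smap_ext => n u; apply: smap_ext.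
Qed.

Lemma wr_wr (X Y A B : sSet) (k : smap X A) (h : smap Y X) (t : acell A B) :
  wr h (wr k t) = wr (k ∘ h) t.
Proof.
rewrite /wr !amap_ho_comp; congr (amap (ho_map _) t).
by apply: smap_ext => n u; apply: smap_ext.
Qed.

Section Interchange.
Variables (X E A : sSet) (qE : quasicategory E) (qA : quasicategory A).

Lemma prod_simplex_nat n (d : smap (sprod (simp 1) X) E) (e : smap (sprod (simp 1) E) A)
    (p q : mono n 1) l m (t : mono l m) (x : sprod (simp n) X m) :
  e l (mono_comp p (act t x).1, d l (mono_comp q (act t x).1, (act t x).2)) =
  act t (e m (mono_comp p x.1, d m (mono_comp q x.1, x.2))).
Proof. by rewrite -smap_nat /= -(smap_nat d). Qed.

Definition prod_simplex n (d : smap (sprod (simp 1) X) E) (e : smap (sprod (simp 1) E) A)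
    (p q : mono n 1) : sexp A X n :=
  SMap (prod_simplex_nat d e p q).

(** Representing edges [e] and [d] give a square Delta^1 x Delta^1 in [A^X]; both composites equal
    its diagonal, through its two nondegenerate triangles. *)
Lemma cell_interchange (s : acell E A) (t : acell X E) f g u u' :
  bnd s f g -> bnd t u u' ->
  acomp (wr u' s) (wl f t) = acomp (wl g t) (wr u s).
Proof.
have [e ->] := arr_edge_exists (sexp_quasicategory (X:=E) qA) s.
have [d ->] := arr_edge_exists (sexp_quasicategory (X:=X) qE) t.
move=> /bnd_edge[<- <-] /bnd_edge[<- <-]; rewrite !wl_edge !wr_edge.
(* These are the sequences 0,0,1 and 0,1,1; the one used in the coordinate of [e] decides which of
   the two cells moves first. *)
pose p0 : mono 2 1 := sigma (@Ordinal 2 0 isT).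
pose p1 : mono 2 1 := sigma (@Ordinal 2 1 isT).
rewrite (@arr_edge_tri _ _ _ (prod_simplex d e (mono_id 1) (mono_id 1))); last first.
  exists (prod_simplex d e p0 p1); split; apply: smap_ext => n [r x] /=;
    congr ((e : smap _ _) n (_, (d : smap _ _) n (_, _))); apply: mono_ext => i /=;
    apply: val_inj; rewrite /=; case: (r i) => [[|[|//]] ?] //.
rewrite (@arr_edge_tri _ _ _ (prod_simplex d e (mono_id 1) (mono_id 1))) //.
exists (prod_simplex d e p1 p0); split; apply: smap_ext => n [r x] /=;
  congr ((e : smap _ _) n (_, (d : smap _ _) n (_, _))); apply: mono_ext => i /=;
  apply: val_inj; rewrite /=; case: (r i) => [[|[|//]] ?] //.
Qed.

End Interchange.

(** * The weak universal property of the comma object *)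

Lemma join_mono m n (t : mono m n) (v : mono m 1) (i j : 'I_m.+1) : i <= j ->
  (if v i == ord0 then ord0 else lift ord0 (t i)) <=
  (if v j == ord0 then ord0 else lift ord0 (t j)).
Proof.
move=> ij; have := monoP v ij; have := monoP t ij.
by rewrite -!val_eqE /=; case: eqP; case: eqP => //=; rewrite /bump; lia.
Qed.

(* The quotient [n] x [1] -> [n+1] collapsing [n] x {0} to the vertex 0. *)
Definition join m n (t : mono m n) (v : mono m 1) : mono m n.+1 :=
  @Mono m n.+1 (fun i => if v i == ord0 then ord0 else lift ord0 (t i))
    (@join_mono m n t v).

Definition suspend_fun m n (s : mono m n) (i : 'I_m.+2) : 'I_n.+2 :=
  if unlift ord0 i is Some a then lift ord0 (s a) else ord0.

Lemma suspend_mono m n (s : mono m n) (i j : 'I_m.+2) : i <= j ->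
  suspend_fun s i <= suspend_fun s j.
Proof.
rewrite /suspend_fun; case: (unliftP ord0 i) => [a ->|->] //.
case: (unliftP ord0 j) => [b ->|->]; last by rewrite /= /bump; lia.
by rewrite /= /bump /= => ab; have := @monoP _ _ s a b; lia.
Qed.

(** The join of the identity of [0] with [s]. *)
Definition suspend m n (s : mono m n) : mono m.+1 n.+1 := Mono (suspend_mono s).

Lemma suspendE m n (s : mono m n) (u : mono m.+1 n.+1) :
  u ord0 = ord0 -> (forall a, u (lift ord0 a) = lift ord0 (s a)) -> u = suspend s.
Proof.
move=> u0 us; apply: mono_ext => i; rewrite /= /suspend_fun.
by case: (unliftP ord0 i) => [a ->|->].
Qed.

Lemma suspend_join l m n (s : mono m n) (t : mono l m) (v : mono l 1) :
  mono_comp (suspend s) (join t v) = join (mono_comp s t) v.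
Proof.
apply: mono_ext => i; rewrite /= /suspend_fun.
by case: ifP => _; rewrite ?liftK ?unlift_none.
Qed.

Section CommaCells.
Variables (A B C : sSet) (f : smap B A) (g : smap C A).

Local Notation F := (comma f g).
Local Notation q0 := (comma0 f g).
Local Notation q1 := (comma1 f g).

Definition comma_psi : acell F A := tarr (comma_cell f g).
Local Notation psi := comma_psi.

Lemma bnd_psi : bnd psi (f ∘ q0) (g ∘ q1).
Proof. exact: bnd_tarr. Qed.

Lemma psi_edge : psi = arr_edge (transpose (comma_arr f g) : sexp A F 1).
Proof. exact: tarr_ho_edge. Qed.

Lemma psi_wr (X : sSet) (a : smap X F) :
  wr a psi = arr_edge (transpose (comma_arr f g ∘ a) : sexp A X 1).
Proof. by rewrite psi_edge wr_edge transpose_comp. Qed.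

Hypothesis qA : quasicategory A.

Lemma comma_1cell (X : sSet) (t : acell X A) b c : bnd t (f ∘ b) (g ∘ c) ->
  exists a : smap X F, [/\ q0 ∘ a = b, q1 ∘ a = c & wr a psi = t].
Proof.
have [e ->] := arr_edge_exists (sexp_quasicategory (X:=X) qA) t.
move=> /bnd_edge[e0 e1]; exists (comma_mk e0 e1).
by rewrite psi_wr comma_mk_arr comma_mk0 comma_mk1.
Qed.

Section Homotopy.
Variables (X : sSet) (b : smap X B) (c : smap X C).

(* The simplices of [A^X] that represent homotopies between arrows [f b => g c]
   fixing the endpoints. *)
Definition fixes_ends n (z : sexp A X n.+1) : Prop :=
  act (vert ord0) z = vtx (f ∘ b) /\ act (delta ord0) z = act (degen n) (vtx (g ∘ c)).

Section Simplex.
Variables (n : nat) (z : sexp A X n.+1) (zP : fixes_ends z).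

Let square_nat l m (t : mono l m) (y : sprod (simp 1) (sprod (simp n) X) m) :
  (z : smap _ _) l (join (act t y).2.1 (act t y).1, (act t y).2.2) =
  act t ((z : smap _ _) m (join y.2.1 y.1, y.2.2)).
Proof.
by rewrite -smap_nat; congr ((z : smap _ _) l (_, _)); apply: mono_ext.
Qed.

Definition square : smap (sprod (simp 1) (sprod (simp n) X)) A := SMap square_nat.

Lemma square0 : square ∘ endpoint _ ord0 = f ∘ (b ∘ ssnd _ _).
Proof.
apply: smap_ext => m [t x] /=.
have := congr1 (fun y : sexp A X 0 => (y : smap _ _) m (degen m, x)) zP.1.
by move=> /= <-; congr ((z : smap _ _) m (_, _)); apply: mono_ext.
Qed.

Lemma square1 : square ∘ endpoint _ ord_max = g ∘ (c ∘ ssnd _ _).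
Proof.
apply: smap_ext => m [t x] /=.
have := congr1 (fun y : sexp A X n => (y : smap _ _) m (t, x)) zP.2.
by move=> /= <-; congr ((z : smap _ _) m (_, _)); apply: mono_ext.
Qed.

(** The vertices of this simplex are the edges of [z] leaving its initial vertex, so a homotopy of
    arrows in [A^X] becomes an edge between functors into the comma object, constant over [B] and
    [C]. *)
Definition comma_simplex : sexp F X n := comma_mk square0 square1.

End Simplex.

Lemma comma_simplex_act m n (s : mono m n) (z : sexp A X n.+1) (z' : sexp A X m.+1)
    (zP : fixes_ends z) (z'P : fixes_ends z') : z' = act (suspend s) z ->
  act s (comma_simplex zP) = comma_simplex z'P.
Proof.
move=> z'E; apply: comma_ext.
- rewrite [act _ _]/(comma_simplex zP ∘ _) -scompA transpose_comp !comma_mk_arr.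
  apply: smap_ext => l [v [t x]] /=; rewrite z'E /=.
  by rewrite (suspend_join s t v).
- by rewrite [act _ _]/(comma_simplex zP ∘ _) -scompA !comma_mk0; apply: smap_ext.
- by rewrite [act _ _]/(comma_simplex zP ∘ _) -scompA !comma_mk1; apply: smap_ext.
Qed.

Lemma comma_simplex0 (a : smap X F) (z : sexp A X 1) (zP : fixes_ends z) :
  q0 ∘ a = b -> q1 ∘ a = c -> transpose (comma_arr f g ∘ a) = z ->
  comma_simplex zP = vtx a.
Proof.
move=> ab ac az; apply: comma_ext.
- rewrite comma_mk_arr -scompA transpose_comp az.
  apply: smap_ext => m [v [t x]] /=; congr ((z : smap _ _) m (_, _)).
  apply: mono_ext => i; apply: val_inj => /=.
  by case: (v i) => [[|[|//]] ?] //=; rewrite [t i]ord1.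
- by rewrite comma_mk0 -scompA ab.
- by rewrite comma_mk1 -scompA ac.
Qed.

Lemma comma_simplex_proj n (z : sexp A X n.+1) (zP : fixes_ends z) :
  spair q1 q0 ∘ (comma_simplex zP : smap _ _) = act (degen n) (vtx (spair c b)).
Proof. exact: smap_ext. Qed.

End Homotopy.

Lemma degen_vtx (D E : sSet) (h : smap D E) m n (t : mono m n) :
  act t (act (degen n) (vtx h)) = act (degen m) (vtx h).
Proof. exact: smap_ext. Qed.

Section FixedHomotopies.
Variables (X : sSet) (b : smap X B) (c : smap X C).
Let y : sexp A X 0 := vtx (g ∘ c).

Lemma fixes_ends_face z e e' : boundary2 z e (deg1 y) e' ->
  fixes_ends b c e -> fixes_ends b c z.
Proof.
move=> [z01 z12 _] [e0 _]; split; last by rewrite (face_delta ord0).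
by rewrite -e0 -z01 -act_comp; congr act; apply: mono_ext => i; apply: val_inj.
Qed.

Lemma fixes_ends_tgt z e e' : boundary2 z e (deg1 y) e' ->
  fixes_ends b c e -> fixes_ends b c e'.
Proof.
move=> zP [e0 e1]; have [_ s t] := boundary2_ends zP.
split; first by rewrite [LHS]s.
have -> : delta ord0 = @vert 1 ord_max by rewrite vert1E; congr delta; apply: val_inj.
by rewrite -/(tgt e') t tgt_deg1 degen_end.
Qed.

(** The horn Lambda^3_1 is formed by [z], a face degenerate at [y] and a face degenerate on [e]. Its
    new face [z'] is the reverse homotopy, and the filler [w], read through [comma_simplex], is a
    triangle whose long edge is degenerate. *)
Lemma comma_homotopy_inverse z e e' (zP : boundary2 z e (deg1 y) e')
    (eP : fixes_ends b c e) (zF : fixes_ends b c z) :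
  exists z' (z'P : boundary2 z' e' (deg1 y) e) (z'F : fixes_ends b c z'),
    acomp (arr_edge (comma_simplex z'F)) (arr_edge (comma_simplex zF)) =
    arr_edge (deg1 (comma_simplex eP)).
Proof.
have ye : tgt e = y by have [-> _ _] := boundary2_ends zP; rewrite src_deg1.
pose s123 := act (degen 2) y.
have s123P : boundary2 s123 (deg1 y) (deg1 y) (deg1 y) by split; rewrite degen_vtx.
have s013P := boundary2_degr e; rewrite ye in s013P.
have [w [z' [[w3 w0 w2 w1] z'P]]] := fill31 (sexp_quasicategory (X:=X) qA) zP s123P s013P.
have e'P := fixes_ends_tgt zP eP.
have z'F := fixes_ends_face z'P e'P.
have s013F := fixes_ends_face s013P eP.
have wF : fixes_ends b c w.
  split; last by rewrite -[RHS]w0; congr (act (delta _) _); apply: val_inj.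
  rewrite -eP.1; have [<- _ _] := zP; rewrite -w3 -!act_comp; congr act.
  by apply: mono_ext => i; apply: val_inj.
exists z', z'P, z'F; apply: arr_edge_tri; exists (comma_simplex wF); split.
- apply: comma_simplex_act; rewrite -w3; congr act; apply: suspendE => [|a];
    apply: val_inj => //; by case: a => [[|[|//]] ?].
- apply: comma_simplex_act; rewrite -w1; congr act; apply: suspendE => [|a];
    apply: val_inj => //; by case: a => [[|[|//]] ?].
- rewrite (comma_simplex_act (z' := act (sigma (@Ordinal 2 1 isT)) e) wF s013F).
    apply/esym/comma_simplex_act; congr act; apply: suspendE => [|a];
      apply: val_inj => //; by case: a => [[|[|//]] ?].
  rewrite -w2; congr act; apply: suspendE => [|a];
    apply: val_inj => //; by case: a => [[|[|//]] ?].
Qed.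

End FixedHomotopies.

Section Uniqueness.
Variables (X : sSet) (a a' : smap X F).
Hypotheses (aa0 : q0 ∘ a = q0 ∘ a') (aa1 : q1 ∘ a = q1 ∘ a').

Let b := q0 ∘ a.
Let c := q1 ∘ a.

Lemma fixes_ends_arr (a1 : smap X F) : q0 ∘ a1 = b -> q1 ∘ a1 = c ->
  fixes_ends b c (transpose (comma_arr f g ∘ a1) : sexp A X 1).
Proof.
move=> e0 e1; split.
  by rewrite -/(src _) src_vtx comma_src e0.
have -> : delta ord0 = @vert 1 ord_max by rewrite vert1E; congr delta; apply: val_inj.
by rewrite -/(tgt _) tgt_vtx comma_tgt e1 degen_end.
Qed.

(* A homotopy is invertible since the inner horn [Lambda^3_1] with degenerate
   last face provides a left inverse. *)
Lemma comma_unique : wr a psi = wr a' psi ->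
  exists t t' : acell X F, [/\ bnd t a a', bnd t' a' a, acomp t' t = aid a,
    acomp t t' = aid a' & wl (spair q1 q0) t = aid (spair q1 q0 ∘ a) /\
    wl (spair q1 q0) t' = aid (spair q1 q0 ∘ a)].
Proof.
pose e := transpose (comma_arr f g ∘ a) : sexp A X 1.
pose e' := transpose (comma_arr f g ∘ a') : sexp A X 1.
rewrite !psi_wr => /(arr_edge_homotopic (sexp_quasicategory (X:=X) qA)) [z zP].
have eP := fixes_ends_arr (erefl b) (erefl c).
have e'P := fixes_ends_arr (esym aa0) (esym aa1).
have ye : tgt (e : sexp A X 1) = vtx (g ∘ c) by rewrite tgt_vtx comma_tgt.
rewrite ye in zP.
have zF : fixes_ends b c z by apply: fixes_ends_face zP eP.
have [z' [z'P [z'F z'z]]] := comma_homotopy_inverse zP eP zF.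
have [z'' [z''P [z''F z''z']]] := comma_homotopy_inverse z'P e'P z'F.
rewrite (comma_simplex0 eP (erefl b)) // in z'z.
rewrite (comma_simplex0 e'P (esym aa0)) // in z''z'.
rewrite arr_edge_deg -/(aid a) in z'z; rewrite arr_edge_deg -/(aid a') in z''z'.
have bn w e1 e2 (a1 a2 : smap X F) (wP : boundary2 w e1 (deg1 (vtx (g ∘ c))) e2)
    (e1P : fixes_ends b c e1) (e2P : fixes_ends b c e2) (wF : fixes_ends b c w) :
    comma_simplex e1P = vtx a1 -> comma_simplex e2P = vtx a2 ->
    bnd (arr_edge (comma_simplex wF)) a1 a2.
  rewrite /bnd => <- <-; have [w01 _ w02] := wP; split; apply: comma_simplex_act.
    rewrite -w01; congr act; apply: suspendE => [|i]; first exact: val_inj.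
    by rewrite [i]ord1; apply: val_inj.
  rewrite -w02; congr act; apply: suspendE => [|i]; first exact: val_inj.
  by rewrite [i]ord1; apply: val_inj.
have ea : comma_simplex eP = vtx a by apply: comma_simplex0.
have ea' : comma_simplex e'P = vtx a' by apply: comma_simplex0.
set t := arr_edge (comma_simplex zF) in z'z.
set t' := arr_edge (comma_simplex z'F) in z'z z''z'.
set t'' := arr_edge (comma_simplex z''F) in z''z'.
have bt : bnd t a a' := bn _ _ _ _ _ zP eP e'P zF ea ea'.
have bt' : bnd t' a' a := bn _ _ _ _ _ z'P e'P eP z'F ea' ea.
have bt'' : bnd t'' a a' := bn _ _ _ _ _ z''P eP e'P z''F ea ea'.
(* [t'] has right inverse [t] and left inverse [t''], so the two agree. *)
have tt'' : t'' = t.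
  by rewrite -[LHS](cell_compm1 bt'') -z'z (cell_compA bt bt' bt'') z''z' (cell_comp1m bt).
rewrite tt'' in z''z'.
have pr w (wF : fixes_ends b c w) :
    wl (spair q1 q0) (arr_edge (comma_simplex wF)) = aid (spair q1 q0 ∘ a).
  rewrite wl_edge comma_simplex_proj -/(deg1 _) arr_edge_deg.
  by apply: tarr_idm; congr vtx; apply: smap_ext.
by exists t, t'; split=> //; split; apply: pr.
Qed.

End Uniqueness.
End CommaCells.

(** * Absolute right liftings *)

Lemma bnd_eq (A B : sSet) (t : acell A B) f f' g g' :
  bnd t f g -> f = f' -> g = g' -> bnd t f' g'.
Proof. by move=> ? <- <-. Qed.

Definition inverse_cells (A B : sSet) (t t' : acell A B) (f g : smap A B) : Prop :=
  [/\ bnd t f g, bnd t' g f, acomp t' t = aid f & acomp t t' = aid g].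

Section InverseCells.
Variables A B : sSet.
Implicit Types (t : acell A B) (f g h : smap A B).

Lemma inverse_cells_sym t t' f g : inverse_cells t t' f g -> inverse_cells t' t g f.
Proof. by case. Qed.

Lemma inverse_cells_eq t t' f f' g g' : inverse_cells t t' f g ->
  f = f' -> g = g' -> inverse_cells t t' f' g'.
Proof. by move=> ? <- <-. Qed.

Lemma inverse_cells_wl (D : sSet) (h : smap B D) t t' f g :
  inverse_cells t t' f g -> inverse_cells (wl h t) (wl h t') (h ∘ f) (h ∘ g).
Proof.
move=> [bt bt' e e']; split; try exact: bnd_wl.
  by rewrite -(wl_comp h bt bt') e wl_aid.
by rewrite -(wl_comp h bt' bt) e' wl_aid.
Qed.

Lemma inverse_cells_wr (X : sSet) (k : smap X A) t t' f g :
  inverse_cells t t' f g -> inverse_cells (wr k t) (wr k t') (f ∘ k) (g ∘ k).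
Proof.
move=> [bt bt' e e']; split; try exact: bnd_wr.
  by rewrite -(wr_comp k bt bt') e wr_aid.
by rewrite -(wr_comp k bt' bt) e' wr_aid.
Qed.

Lemma cell_cancell t t' s f g h : inverse_cells t t' g h -> bnd s f g ->
  acomp t' (acomp t s) = s.
Proof.
by move=> [bt bt' e _] bs; rewrite (cell_compA bs bt bt') e (cell_comp1m bs).
Qed.

Lemma cell_cancelr t t' s f g h : inverse_cells t t' f g -> bnd s g h ->
  acomp (acomp s t) t' = s.
Proof.
by move=> [bt bt' _ e] bs; rewrite -(cell_compA bt' bt bs) e (cell_compm1 bs).
Qed.

Lemma iso1cellsP (f g : smap A B) :
  iso1cells f g <-> exists t t', inverse_cells t t' f g.
Proof.
split=> [[a [b [ba ab]]]|[t [t' [/bndP[a ->] /bndP[b ->] ba ab]]]].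
  by exists (tarr a), (tarr b); split=> //; rewrite acompE (ba, ab).
by exists a, b; split; apply: tarr_inj; rewrite -acompE.
Qed.

End InverseCells.

(** The lift [t] is v s conjugated by [h] : v w ~ id. Naturality of [h] gives v w t = v s, and
    whiskering with [v] is faithful because w v ~ id. *)
Lemma equivalence_full (E F : sSet) (qE : quasicategory E) (qF : quasicategory F)
    (w : smap E F) : equivalence w ->
  forall (X : sSet) (z z' : smap X E) (s : acell X F), bnd s (w ∘ z) (w ∘ z') ->
  exists2 t, bnd t z z' & wl w t = s.
Proof.
move=> [v [/iso1cellsP[h [h' hP]] /iso1cellsP[e [e' eP]]]] X z z' s bs.
have [bh bh' _ _] := hP; have [be be' _ _] := eP.
have bhz : bnd (wr z h') z (v ∘ (w ∘ z)).
  by apply: bnd_eq (bnd_wr z bh') _ _; apply: smap_ext.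
have bhz' : bnd (wr z' h) (v ∘ (w ∘ z')) z'.
  by apply: bnd_eq (bnd_wr z' bh) _ _; apply: smap_ext.
have bvs := bnd_wl v bs.
pose t := acomp (wr z' h) (acomp (wl v s) (wr z h')).
have bt : bnd t z z' := bnd_comp (bnd_comp bhz bvs) bhz'.
(* Naturality of [e] recovers a cell from its whiskering with w v. *)
have faithful s1 s2 (y y' : smap X F) : bnd s1 y y' -> bnd s2 y y' ->
    wl v s1 = wl v s2 -> s1 = s2.
  have ey (y0 : smap X F) : inverse_cells (wr y0 e) (wr y0 e') (w ∘ v ∘ y0) y0.
    by apply: inverse_cells_eq (inverse_cells_wr y0 eP) _ _; [|apply: smap_ext].
  move=> b1 b2 e12; rewrite -(cell_cancelr (ey y) b1) -(cell_cancelr (ey y) b2).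
  have := cell_interchange qF qF be b1; have := cell_interchange qF qF be b2.
  by rewrite -!wl_wl e12 !wl_sid => <- <-.
exists t => //; apply: (faithful _ _ (w ∘ z) (w ∘ z')) => //; first exact: bnd_wl.
have hz' : inverse_cells (wr z' h) (wr z' h') (v ∘ (w ∘ z')) z'.
  by apply: inverse_cells_eq (inverse_cells_wr z' hP) _ _; apply: smap_ext.
have hz : inverse_cells (wr z h') (wr z h) z (v ∘ (w ∘ z)).
  apply: inverse_cells_eq (inverse_cells_wr z (inverse_cells_sym hP)) _ _; exact: smap_ext.
have bvwt : bnd (wl v (wl w t)) (v ∘ (w ∘ z)) (v ∘ (w ∘ z')) := bnd_wl v (bnd_wl w bt).
rewrite -(cell_cancell hz' bvwt) -[RHS](cell_cancell hz' bvs); congr acomp.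
have := cell_interchange qE qE bh bt; rewrite -wl_wl wl_sid => ->.
rewrite /t (cell_compA bhz bvs bhz').
by rewrite (cell_cancelr hz (bnd_comp bvs bhz')).
Qed.

(** * Functors over C x B between the comma objects, and the 2-cells inducing them *)

Section AbsoluteLifting.
Variables (A B C : sSet) (f : smap B A) (g : smap C A) (l : smap C B).
Hypotheses (qA : quasicategory A) (qB : quasicategory B) (qC : quasicategory C).

Local Notation F := (comma f g).
Local Notation q0 := (comma0 f g).
Local Notation q1 := (comma1 f g).
Local Notation E := (comma (sid B) l).
Local Notation p0 := (comma0 (sid B) l).
Local Notation p1 := (comma1 (sid B) l).
Local Notation psi := (comma_psi f g).

Let qF : quasicategory F := comma_quasicategory qA qB qC.
Let qE : quasicategory E := comma_quasicategory qB qB qC.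

Definition phi : acell E B := comma_psi (sid B) l.

Lemma tarr_comma_cell1 : tarr (comma_cell1 l) = phi.
Proof. exact: tarr_ccast. Qed.

Lemma bnd_phi : bnd phi p0 (l ∘ p1).
Proof. by apply: bnd_eq (bnd_psi _ _) _ _; first exact: scomp1s. Qed.

Definition apaste (X : sSet) (lam : acell C A) (t : acell X B) (c : smap X C) :
  acell X A := acomp (wr c lam) (wl f t).

Lemma tarr_paste X (lam : cell (f ∘ l) g) (b : smap X B) (c : smap X C)
  (t : cell b (l ∘ c)) : tarr (paste lam t) = apaste (tarr lam) (tarr t) c.
Proof. by rewrite tarr_vcomp tarr_ccast tarr_whiskr tarr_whiskl. Qed.

Section Paste.
Variables (lam : acell C A) (blam : bnd lam (f ∘ l) g).

Lemma bnd_wr_lam (X : sSet) (c : smap X C) : bnd (wr c lam) (f ∘ (l ∘ c)) (g ∘ c).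
Proof. by rewrite -scompA; apply: bnd_wr. Qed.

Lemma bnd_apaste X (b : smap X B) (c : smap X C) t : bnd t b (l ∘ c) ->
  bnd (apaste lam t c) (f ∘ b) (g ∘ c).
Proof. by move=> bt; apply: bnd_comp (bnd_wl f bt) (bnd_wr_lam c). Qed.

Lemma apaste_wr X Y (k : smap Y X) (b : smap X B) (c : smap X C) t : bnd t b (l ∘ c) ->
  wr k (apaste lam t c) = apaste lam (wr k t) (c ∘ k).
Proof.
by move=> bt; rewrite /apaste (wr_comp k (bnd_wl f bt) (bnd_wr_lam c)) wr_wr wl_wr.
Qed.

End Paste.

Lemma inducesP (lam : cell (f ∘ l) g) w : induces lam w <->
  [/\ q0 ∘ w = p0, q1 ∘ w = p1 & wr w psi = apaste (tarr lam) phi p1].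
Proof.
have e : ceq (whiskr (comma_cell f g) w) (paste lam (comma_cell1 l)) <->
    wr w psi = apaste (tarr lam) phi p1.
  by rewrite ceq_tarr tarr_whiskr tarr_paste tarr_comma_cell1.
by split=> [[w0 w1 /e]|[w0 w1 /e]].
Qed.

Lemma induces_exists (lam : cell (f ∘ l) g) : exists w, induces lam w.
Proof.
have [w [w0 w1 wpsi]] := comma_1cell qA (bnd_apaste (bnd_tarr lam) bnd_phi).
by exists w; apply/inducesP.
Qed.

Lemma slice_proj (x : comma_slice_hom f g l) :
  q0 ∘ slice1_map x = p0 /\ q1 ∘ slice1_map x = p1.
Proof.
split; [have := congr1 (scomp (ssnd C B)) (svalP x)|
        have := congr1 (scomp (sfst C B)) (svalP x)]; rewrite -!scompA.
  by move=> e; apply: etrans (etrans e _); apply: smap_ext.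
by move=> e; apply: etrans (etrans e _); apply: smap_ext.
Qed.

Lemma wl_spair X (t : acell X F) b c : wl (spair q1 q0) t = aid (spair c b) ->
  wl q0 t = aid b /\ wl q1 t = aid c.
Proof.
move=> tid.
have e0 : q0 = ssnd C B ∘ spair q1 q0 by exact: smap_ext.
have e1 : q1 = sfst C B ∘ spair q1 q0 by exact: smap_ext.
by split; [rewrite [q0 in LHS]e0|rewrite [q1 in LHS]e1]; rewrite -wl_wl tid wl_aid;
  congr aid; apply: smap_ext.
Qed.

Lemma bnd_wr_psi X (w : smap X F) b c : q0 ∘ w = b -> q1 ∘ w = c ->
  bnd (wr w psi) (f ∘ b) (g ∘ c).
Proof. by move=> <- <-; apply: bnd_eq (bnd_wr w (bnd_psi f g)) _ _; apply: scompA. Qed.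

(** A 2-cell over C x B becomes an identity under [q0] and [q1], so its interchange with psi equates
    the two restrictions of psi; the converse is [comma_unique]. *)
Lemma slice_isomorphic (x y : comma_slice_hom f g l) :
  isomorphic x y <-> wr (slice1_map x) psi = wr (slice1_map y) psi.
Proof.
have [x0 x1] := slice_proj x; have [y0 y1] := slice_proj y.
split=> [[t _]|psixy].
  have bt : bnd (tarr (sval t)) (slice1_map x) (slice1_map y) := bnd_tarr _.
  have /ceq_tarr := svalP t; rewrite tarr_whiskl => /wl_spair[t0 t1].
  have := cell_interchange qF qA (bnd_psi f g) bt.
  rewrite -(wl_wl q0 f) -(wl_wl q1 g) t0 t1 !wl_aid.
  by rewrite (cell_compm1 (bnd_wr_psi y0 y1)) (cell_comp1m (bnd_wr_psi x0 x1)).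
have [|||t [t' [bt bt' t't tt' [tid t'id]]]] :=
  @comma_unique A B C f g qA E (slice1_map x) (slice1_map y).
- by rewrite x0 y0.
- by rewrite x1 y1.
- by [].
have {bt}[a aE] := bndP bt; have {bt'}[b bE] := bndP bt'.
have ux := svalP x; rewrite /= in ux.
have aP : ceq (whiskl (spair q1 q0) a) (Defs.cid (spair p1 p0)).
  by apply/ceq_tarr; rewrite tarr_whiskl -aE tid; apply: tarr_idm; rewrite ux.
have bP : ceq (whiskl (spair q1 q0) b) (Defs.cid (spair p1 p0)).
  by apply/ceq_tarr; rewrite tarr_whiskl -bE t'id; apply: tarr_idm; rewrite ux.
exists (exist _ a aP), (exist _ b bP); split; apply: sval_inj; apply: tarr_inj.
  by rewrite tarr_vcomp -aE -bE.
by rewrite tarr_vcomp -aE -bE.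
Qed.

Section UnitSection.

Lemma unit_section_src : (l ∘ ssnd (simp 1) C) ∘ endpoint C ord0 = sid B ∘ l.
Proof. exact: smap_ext. Qed.

Lemma unit_section_tgt : (l ∘ ssnd (simp 1) C) ∘ endpoint C ord_max = l ∘ sid C.
Proof. exact: smap_ext. Qed.

(** The section of [p1] that sends c to the identity arrow of l c. *)
Definition unit_section : smap C E := comma_mk unit_section_src unit_section_tgt.

Lemma unit_section_phi : wr unit_section phi = aid l.
Proof. by rewrite psi_wr comma_mk_arr /aid -arr_edge_deg; congr arr_edge; apply: smap_ext. Qed.

Let H := transpose (comma_arr (sid B) l).

Lemma max_mono m (s v : mono m 1) (i j : 'I_m.+1) : i <= j ->
  (if v i == ord0 then s i else ord_max) <= (if v j == ord0 then s j else ord_max).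
Proof.
move=> ij; have := monoP v ij; have := monoP s ij; rewrite -!val_eqE /=.
by have := ltn_ord (s i); case: eqP; case: eqP => //=; lia.
Qed.

(* Contraction of [Delta^1] onto its last vertex, whence [contraction], the unit
   [id => i p_1] of the adjunction between [p_1] and its section. *)
Definition max_op m (s v : mono m 1) : mono m 1 := Mono (max_mono s v).

Lemma contraction_nat m n (t : mono m n) (y : sprod (simp 1) (sprod (simp 1) E) n) :
  H m (max_op (act t y).2.1 (act t y).1, (act t y).2.2) =
  act t (H n (max_op y.2.1 y.1, y.2.2)).
Proof. by rewrite -smap_nat; congr (H m (_, _)); apply: mono_ext. Qed.

Lemma contraction_src : SMap contraction_nat ∘ endpoint _ ord0 = sid B ∘ H.
Proof.
by apply: smap_ext => m [s x] /=; congr (H m (_, x)); apply: mono_ext.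
Qed.

Lemma contraction_tgt :
  SMap contraction_nat ∘ endpoint _ ord_max = l ∘ (p1 ∘ ssnd (simp 1) E).
Proof.
have := comma_tgt (sid E : smap E E).
rewrite (_ : comma_arr _ _ ∘ sid E = comma_arr _ _); last exact: smap_ext.
move=> e; apply: smap_ext => m [s x].
have /= := congr1 (fun h : smap E B => h m x) e => <-.
by congr (H m (_, x)); apply: mono_ext.
Qed.

(** At an object beta : b -> l c, this edge is the square from beta to the identity of l c whose
    sides are beta and an identity. *)
Definition contraction : sexp E E 1 := comma_mk contraction_src contraction_tgt.

Lemma bnd_contraction : bnd (arr_edge contraction) (sid E) (unit_section ∘ p1).
Proof.
have H0 : H ∘ endpoint E ord0 = p0.
  have := comma_src (sid E : smap E E).
  by rewrite (_ : comma_arr _ _ ∘ sid E = comma_arr _ _) => [->|]; apply: smap_ext.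
have H1 : H ∘ endpoint E ord_max = l ∘ p1.
  have := comma_tgt (sid E : smap E E).
  by rewrite (_ : comma_arr _ _ ∘ sid E = comma_arr _ _) => [->|]; apply: smap_ext.
apply/bnd_edge; split; apply: comma_ext.
- rewrite -scompA transpose_comp comma_mk_arr.
  apply: smap_ext => m [v x] /=; congr (H m (_, x)); apply: mono_ext => i /=.
  case: ifP => [/eqP -> //|/negbT]; rewrite -val_eqE /= => vi; apply: val_inj => /=.
  by case: (v i) vi => [[|[|//]] ?].
- by rewrite -[LHS]scompA comma_mk0 H0; apply: smap_ext.
- by rewrite -[LHS]scompA comma_mk1; apply: smap_ext.
- rewrite -(scompA _ contraction) -(scompA _ unit_section) [LHS]transpose_comp [RHS]transpose_comp.
  rewrite /contraction /unit_section !comma_mk_arr.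
  apply: smap_ext => m [v x] /=.
  have /= <- := congr1 (fun h : smap E B => h m x) H1.
  by congr (H m (_, x)); apply: mono_ext => i /=; case: ifP.
- rewrite -[LHS]scompA comma_mk0 H1 -[RHS]scompA comma_mk0 //.
- by rewrite -[LHS]scompA comma_mk1 -[RHS]scompA comma_mk1; apply: smap_ext.
Qed.

Lemma contraction0 : wl p0 (arr_edge contraction) = phi.
Proof. by rewrite wl_edge comma_mk0 /phi psi_edge. Qed.

Lemma contraction1 : wl p1 (arr_edge contraction) = aid p1.
Proof. by rewrite wl_edge comma_mk1 /aid -arr_edge_deg; congr arr_edge; apply: smap_ext. Qed.

End UnitSection.

Lemma apaste_phi_inj (lam lam' : acell C A) : bnd lam (f ∘ l) g -> bnd lam' (f ∘ l) g ->
  apaste lam phi p1 = apaste lam' phi p1 -> lam = lam'.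
Proof.
have e lam0 : bnd lam0 (f ∘ l) g -> wr unit_section (apaste lam0 phi p1) = lam0.
  move=> b0; rewrite (apaste_wr b0 _ bnd_phi) unit_section_phi /apaste.
  by rewrite comma_mk1 wr_sid wl_aid (cell_compm1 b0).
by move=> b0 b1 e01; rewrite -(e _ b0) e01 e.
Qed.

Lemma induces_surj (w : smap E F) : q0 ∘ w = p0 -> q1 ∘ w = p1 ->
  exists lam : cell (f ∘ l) g, induces lam w.
Proof.
move=> w0 w1; have bpsi := bnd_wr_psi w0 w1.
have blam : bnd (wr unit_section (wr w psi)) (f ∘ l) g.
  apply: bnd_eq (bnd_wr unit_section bpsi) _ _; first by rewrite scompA comma_mk0.
  by rewrite scompA comma_mk1 scomps1.
have [lam lamE] := bndP blam; exists lam; apply/inducesP; split=> //.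
have := cell_interchange qE qA bpsi bnd_contraction.
rewrite -(wl_wl p0 f) -(wl_wl p1 g) contraction0 contraction1 wl_aid wr_sid (cell_comp1m bpsi) => <-.
by rewrite /apaste -lamE (wr_wr unit_section p1).
Qed.

Lemma absolute_right_liftingP (lam : cell (f ∘ l) g) :
  absolute_right_lifting lam <->
  forall X, quasicategory X -> forall (b : smap X B) (c : smap X C) chi,
  bnd chi (f ∘ b) (g ∘ c) -> exists t, [/\ bnd t b (l ∘ c),
    chi = apaste (tarr lam) t c &
    forall t', bnd t' b (l ∘ c) -> chi = apaste (tarr lam) t' c -> t' = t].
Proof.
split=> h X qX b c chi.
  move=> /bndP[x ->]; have [t [tE tu]] := h X qX b c x.
  exists (tarr t); split=> //; first by rewrite tE tarr_paste.
  move=> _ /bndP[t' ->]; rewrite -tarr_paste => /tarr_inj /tu ->; by [].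
have [t [/bndP[x ->] tE tu]] := h X qX b c _ (bnd_tarr chi).
exists x; split; first by apply: tarr_inj; rewrite tarr_paste.
by move=> t' t'E; apply: tarr_inj; rewrite (tu (tarr t')) // t'E tarr_paste.
Qed.

(** * Absolute liftings correspond to equivalences *)

Section Universal.
Variables (lam : cell (f ∘ l) g) (w : smap E F).
Hypotheses (w0 : q0 ∘ w = p0) (w1 : q1 ∘ w = p1).
Hypothesis wpsi : wr w psi = apaste (tarr lam) phi p1.

Let blam := bnd_tarr lam.

Lemma absolute_equivalence : absolute_right_lifting lam -> equivalence w.
Proof.
move=> /absolute_right_liftingP abs.
(* The functor [v] named by the factorisation [t] of psi through [lam] is the candidate inverse of
   [w]. *)
have [t [bt tE _]] := abs F qF q0 q1 psi (bnd_psi f g).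
have [|v [v0 v1 vphi]] := @comma_1cell B B C (sid B) l qB F t q0 q1.
  by apply: bnd_eq bt _ _ => //; rewrite scomp1s.
exists v; split; apply/iso1cellsP.
  have [|||t1 [t2 [? ? ? ? _]]] := @comma_unique B B C (sid B) l qB E (v ∘ w) (sid E).
  - by rewrite -scompA v0 w0 scomps1.
  - by rewrite -scompA v1 w1 scomps1.
  - rewrite -wr_wr wr_sid -/phi vphi.
    (* Both [phi] and the restriction of [t] along [w] factor the restriction of psi along [w], so
       uniqueness identifies them. *)
    have [t0 [_ _ t0u]] := abs E qE p0 p1 _ (bnd_wr_psi w0 w1).
    rewrite (t0u phi) //; last exact: bnd_phi.
    apply: t0u; first by apply: bnd_eq (bnd_wr w bt) w0 _; rewrite scompA w1.
    by rewrite {1}tE (apaste_wr blam w bt) w1.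
  by exists t1, t2.
have [|||t1 [t2 [? ? ? ? _]]] := @comma_unique A B C f g qA F (w ∘ v) (sid F).
- by rewrite -scompA w0 v0 scomps1.
- by rewrite -scompA w1 v1 scomps1.
- by rewrite -wr_wr wpsi (apaste_wr blam v bnd_phi) vphi v1 wr_sid.
by exists t1, t2.
Qed.

Lemma apaste_wr_phi X (z : smap X E) :
  apaste (tarr lam) (wr z phi) (p1 ∘ z) = wr (w ∘ z) psi.
Proof. by rewrite -wr_wr wpsi (apaste_wr blam z bnd_phi). Qed.

Lemma equivalence_lift : equivalence w ->
  exists2 t, bnd t q0 (l ∘ q1) & apaste (tarr lam) t q1 = psi.
Proof.
move=> [v [_ /iso1cellsP[e [e' eP]]]]; have [be be' ee' e'e] := eP.
have be1 : bnd (wl q1 e) (p1 ∘ v) q1.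
  by apply: bnd_eq (bnd_wl q1 be) _ _; rewrite ?scomps1 // -scompA w1.
have be0' : bnd (wl q0 e') q0 (p0 ∘ v).
  by apply: bnd_eq (bnd_wl q0 be') _ _; rewrite ?scomps1 // -scompA w0.
have bphi : bnd (wr v phi) (p0 ∘ v) (l ∘ (p1 ∘ v)).
  by apply: bnd_eq (bnd_wr v bnd_phi) _ _; rewrite ?scompA.
have ble := bnd_wl l be1; have bt := bnd_comp be0' bphi.
exists (acomp (wl l (wl q1 e)) (acomp (wr v phi) (wl q0 e'))); first exact: bnd_comp bt ble.
rewrite /apaste (wl_comp f bt ble).
rewrite (cell_compA (bnd_wl f bt) (bnd_wl f ble) (bnd_wr_lam blam q1)).
(* Interchange moves [q1 e] past [lam], which exposes the restriction of psi along w v. *)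
have := cell_interchange qC qA blam be1; rewrite -wl_wl => ->.
have bwl := bnd_wr_lam blam (p1 ∘ v); have bge := bnd_wl g be1.
rewrite -(cell_compA (bnd_wl f bt) bwl bge) (wl_comp f be0' bphi).
rewrite (cell_compA (bnd_wl f be0') (bnd_wl f bphi) bwl).
rewrite -/(apaste _ _ _) apaste_wr_phi.
have bwv : bnd (wr (w ∘ v) psi) (f ∘ (p0 ∘ v)) (g ∘ (p1 ∘ v)).
  by apply: bnd_wr_psi; rewrite -scompA ?w0 ?w1.
rewrite (cell_compA (bnd_wl f be0') bwv bge) (wl_wl q1 g).
(* Naturality of psi along [e] produces [f q0 e], which cancels against [f q0 e']. *)
have := cell_interchange qF qA (bnd_psi f g) be; rewrite wr_sid => <-.
rewrite (wl_wl q0 f); apply: cell_cancelr (bnd_psi f g).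
by apply: inverse_cells_eq (inverse_cells_wl (f ∘ q0) eP) _ _; rewrite ?scomps1.
Qed.

Lemma equivalence_absolute : equivalence w -> absolute_right_lifting lam.
Proof.
move=> weq; have [t bt tpsi] := equivalence_lift weq.
apply/absolute_right_liftingP => X qX b c chi bchi.
have [a [a0 a1 achi]] := comma_1cell qA bchi.
have bta : bnd (wr a t) b (l ∘ c).
  by apply: bnd_eq (bnd_wr a bt) a0 _; rewrite scompA a1.
have tchi : chi = apaste (tarr lam) (wr a t) c.
  by rewrite -achi -tpsi (apaste_wr blam a bt) a1.
exists (wr a t); split=> // t' bt' t'chi.
have lift s : bnd s b (l ∘ c) -> exists z : smap X E,
    [/\ p0 ∘ z = b, p1 ∘ z = c & wr z phi = s].
  by move=> bs; apply: (comma_1cell qB); rewrite scomp1s.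
(* Two factorisations of [chi] are named by [z] and [z']. Their composites with [w] both name [chi],
   hence are isomorphic over C x B. *)
have [z [z0 z1 zE]] := lift _ bta; have [z' [z0' z1' zE']] := lift _ bt'.
have [|||s [s' [bs _ _ _ [sid_ _]]]] := @comma_unique A B C f g qA X (w ∘ z) (w ∘ z').
- by rewrite -!scompA w0 z0 z0'.
- by rewrite -!scompA w1 z1 z1'.
- by rewrite -!apaste_wr_phi zE zE' z1 z1' -tchi -t'chi.
have [r br rs] := equivalence_full qE qF weq bs.
have spairE : spair q1 q0 ∘ (w ∘ z) = spair c b.
  by rewrite -z0 -z1 -w0 -w1; apply: smap_ext.
rewrite spairE in sid_; have [s0 s1] := wl_spair sid_.
have r0 : wl p0 r = aid b by rewrite -w0 -(wl_wl w q0) rs.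
have r1 : wl p1 r = aid c by rewrite -w1 -(wl_wl w q1) rs.
(* The lifted cell [r] projects to identities, so its interchange with [phi] equates the two
   factorisations. *)
have := cell_interchange qE qB bnd_phi br.
rewrite -(wl_wl p1 l) r0 r1 wl_aid zE zE'.
by rewrite (cell_compm1 bt') (cell_comp1m bta).
Qed.

End Universal.
End AbsoluteLifting.
Theorem proposition5p1p8 (A B C : sSet) (qA : quasicategory A)
    (qB : quasicategory B) (qC : quasicategory C)
    (f : smap B A) (g : smap C A) (l : smap C B) :
  exists Phi : cell (f ∘ l) g -> iso_class (comma_slice_hom f g l),
  [/\ (forall lam : cell (f ∘ l) g,
         exists w : smap (comma (sid B) l) (comma f g), induces lam w),
      (forall (lam : cell (f ∘ l) g) (w : smap (comma (sid B) l) (comma f g))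
         (hw : induces lam w), Phi lam = class_of (induced_slice1 hw)),
      bijective Phi &
      (forall (lam : cell (f ∘ l) g) (w : comma_slice_hom f g l),
         Phi lam = class_of w ->
         (absolute_right_lifting lam <-> equivalence (slice1_map w)))].
Proof.
have [w wP] := boolp.choice (induces_exists qA (f:=f) (g:=g) (l:=l)).
pose Phi lam := class_of (induced_slice1 (wP lam)).
have isoE := slice_isomorphic qA qB qC (f:=f) (g:=g) (l:=l).
have clsE (x y : comma_slice_hom f g l) : class_of x = class_of y <->
    wr (slice1_map x) (comma_psi f g) = wr (slice1_map y) (comma_psi f g).
  by rewrite -isoE; apply: cls_eq; apply: isomorphic_equiv.
(* Isomorphism classes are detected by the restriction of psi, so every representative of the class
   is itself induced by [lam]. Independence of the choice of [w] and the last clause of the theorem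
   rest on this. *)
have PhiP lam x : Phi lam = class_of x <-> induces lam (slice1_map x).
  have [_ _ e] := (inducesP lam (w lam)).1 (wP lam).
  have [x0 x1] := slice_proj x.
  rewrite clsE /= e; split=> [ex|/inducesP[_ _ ->] //].
  by apply/inducesP.
exists Phi; split.
- by move=> lam; exists (w lam).
- by move=> lam v vP; apply/PhiP.
- have inj : injective Phi.
    move=> lam lam' /PhiP/inducesP[_ _ e].
    have [_ _ e'] := (inducesP lam' (w lam')).1 (wP lam').
    by apply: tarr_inj; apply: (apaste_phi_inj (bnd_tarr lam) (bnd_tarr lam')); rewrite -e.
  have surj q : exists lam, Phi lam = q.
    have [x ->] := Defs.quotP q; have [x0 x1] := slice_proj x.
    by have [lam lamP] := induces_surj qA qB qC x0 x1; exists lam; apply/PhiP.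
  have [Psi PsiK] := boolp.choice surj.
  by exists Psi => // lam; apply: inj; rewrite PsiK.
- move=> lam x /PhiP/inducesP[x0 x1 e]; split.
    exact: (absolute_equivalence qA qB qC x0 x1 e).
  exact: (equivalence_absolute qA qB qC x0 x1 e).
Qed.
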